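(* Let $G$ be a quasi-banana graph with (first) gonality $k$. For every integer $\ell\ge 1$, the graph $\sigma_\ell(G)$ is gonality-tight with (first) gonality $k$. In particular, if $\Gamma$ is the metric graph obtained from $G$ by assigning length $1$ to each edge, then $\Gamma$ is gonality-tight as well.
   Context: All graphs are finite connected loopless multigraphs. A divisor on a graph $G$ is an element $D=\sum_{w\in V(G)}D(w)\cdot w$ of the free abelian group on $V(G)$; its degree is $\deg(D)=\sum_w D(w)$, and it is effective if $D(w)\ge 0$ for all $w$. Firing a vertex $v$ replaces $D$ by the divisor in which $v$ loses one chip along each incident edge and the vertex at the other end of each such edge gains one chip. Two divisors are linearly equivalent if one is obtained from the other by a finite sequence of firings and inverse firings. The rank of $D$ is $-1$ if $D$ is not equivalent to an effective divisor, and otherwise is the largest integer $r\ge 0$ such that $D-E$ is equivalent to an effective divisor for every effective divisor $E$ of degree $r$. The $r$-th gonality $\mathrm{gon}_r(G)$ is the smallest degree of a divisor of rank $r$ on $G$; ''gonality'' alone means first gonality. $G$ is gonality-tight if $\mathrm{gon}_2(G)=\mathrm{gon}_1(G)+1$. For an integer $\ell\ge 1$, $\sigma_\ell(G)$ denotes the graph obtained from $G$ by subdividing every edge $\ell$ times (each edge is replaced by a path with $\ell$ new interior vertices, i.e. with $\ell+1$ edges). For a metric graph $\Gamma$, a divisor is an element of the free abelian group on the points of $\Gamma$; two divisors are linearly equivalent if they differ by $\mathrm{div}(f)$ for a continuous piecewise linear function $f:\Gamma\to\mathbb{R}$ with integer slopes, where $\mathrm{div}(f)(p)$ is the sum of the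 incoming slopes of $f$ at $p$. Degree, effectiveness, rank, gonalities $\mathrm{gon}_r(\Gamma)$ and gonality-tightness are then defined as for graphs. Quasi-banana graphs: let $m\ge 0$ be an integer and $N=(q_1,\dots,q_m)$ an $m$-tuple of positive integers. The graph $QB_m(N)$ has vertex set $\bigcup_{i=0}^m C_i$ (a disjoint union), where $C_0=\{u_{0,1}\}$ and $C_i=\{u_{i,j}\mid 1\le j\le q_i\}$ for $1\le i\le m$. Its edges are: (1) for each $1\le i\le m$ and distinct $1\le j,k\le q_i$, exactly one edge between $u_{i,j}$ and $u_{i,k}$; (2) for each $0\le i<m$ and $1\le j\le q_{i+1}$, exactly $\sum_{k=1}^{i}q_k+2$ edges between $u_{i,1}$ and $u_{i+1,j}$; (3) no other edges. A quasi-banana graph is a graph isomorphic to some $QB_m(N)$. *)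

(* Defs.v *)
From HB Require Import structures.
From Stdlib Require Import Relation_Operators.
From mathcomp Require Import all_boot all_order all_algebra.
From mathcomp Require Import boolp classical_sets reals.
From mathcomp.multinomials Require Import freeg.

Set Implicit Arguments.
Unset Strict Implicit.
Unset Printing Implicit Defensive.

Import Order.TTheory GRing.Theory Num.Theory.

Local Open Scope ring_scope.

Definition adjacent (V E : finType) (s t : E -> V) : rel V :=
  fun x y => [exists e, ((s e == x) && (t e == y)) || ((s e == y) && (t e == x))].

(* Edges are elements of a finite type, so parallel edges are allowed.  The
   names src/tgt fix an arbitrary orientation of each edge, used only for
   bookkeeping. *)
Record graph := Graph {
  vertex : finType;
  edge : finType;
  src : edge -> vertex;
  tgt : edge -> vertex;
  loopless : forall e, src e != tgt e;
  nonempty : (0 < #|vertex|)%N;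
  connected : forall x y, connect (adjacent src tgt) x y }.

Definition isomorphic (G H : graph) : Prop :=
  exists (fV : vertex G -> vertex H) (fE : edge G -> edge H),
    [/\ bijective fV, bijective fE &
        forall e, (src (fE e) = fV (src e) /\ tgt (fE e) = fV (tgt e)) \/
                  (src (fE e) = fV (tgt e) /\ tgt (fE e) = fV (src e))].

(* [lineq] is chip-firing equivalence on a graph, or linear equivalence on a
   metric graph.  The degree is [deg] from freeg. *)
Section Gonality.
Variables (P : choiceType) (lineq : {freeg P} -> {freeg P} -> Prop).
Implicit Types D E : {freeg P}.

Definition effective D : Prop := forall p, 0 <= coeff p D.

Definition equiv_effective D : Prop := exists2 D', effective D' & lineq D D'.

Definition rank_ge D (r : nat) : Prop :=
  forall E, effective E -> deg E = r%:Z -> equiv_effective (D - E).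

Definition is_rank D (r : int) : Prop :=
  (~ equiv_effective D /\ r = -1) \/
  (equiv_effective D /\
   exists n : nat, [/\ r = n%:Z, rank_ge D n &
                       forall n', rank_ge D n' -> (n' <= n)%N]).

Definition is_gonality (r : nat) (k : int) : Prop :=
  (exists2 D, is_rank D r%:Z & deg D = k) /\
  (forall D, is_rank D r%:Z -> k <= deg D).

Definition gonality_tight : Prop :=
  exists k : int, is_gonality 1 k /\ is_gonality 2 (k + 1).

End Gonality.

Section ChipFiring.
Variable G : graph.

Definition fire (v : vertex G) (D : {freeg vertex G}) : {freeg vertex G} :=
  D + \sum_(e : edge G | src e == v) (<< tgt e >> - << v >>)
    + \sum_(e : edge G | tgt e == v) (<< src e >> - << v >>).

Definition firing_step (D D' : {freeg vertex G}) : Prop :=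
  exists v, D' = fire v D \/ D = fire v D'.

Definition chip_equiv : {freeg vertex G} -> {freeg vertex G} -> Prop :=
  clos_refl_trans _ firing_step.

End ChipFiring.

Definition graph_gonality (G : graph) := is_gonality (@chip_equiv G).
Definition graph_gonality_tight (G : graph) := gonality_tight (@chip_equiv G).

Lemma adjacent_connect_sym (V E : finType) (s t : E -> V) :
  connect_sym (adjacent s t).
Proof.
by apply: sym_connect_sym => x y; apply: eq_existsb => e; rewrite orbC.
Qed.

Section Subdivision.
Variables (l : nat) (G : graph).

Definition sub_vertex : finType := (vertex G + edge G * 'I_l)%type.
Definition sub_edge : finType := (edge G * 'I_l.+1)%type.

(* The k-th vertex, 0 <= k <= l + 1, of the path replacing the edge [e]:
   k = 0 is [src e], k = l + 1 is [tgt e], and 1 <= k <= l is the new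
   vertex [inr (e, k - 1)]. *)
Definition sub_point (e : edge G) (k : nat) : sub_vertex :=
  if k is k'.+1 then
    if insub k' is Some i then inr (e, i) else inl (tgt e)
  else inl (src e).

Definition sub_src (x : sub_edge) : sub_vertex := sub_point x.1 x.2.
Definition sub_tgt (x : sub_edge) : sub_vertex := sub_point x.1 x.2.+1.

Lemma sub_pointS (e : edge G) (i : 'I_l) : sub_point e i.+1 = inr (e, i).
Proof. by rewrite /= valK. Qed.

Lemma sub_point_max (e : edge G) : sub_point e l.+1 = inl (tgt e).
Proof. by rewrite /= insubN // ltnn. Qed.

Lemma sub_loopless x : sub_src x != sub_tgt x.
Proof.
case: x => e [[|i] /= hi]; rewrite /sub_src /sub_tgt /=.
  case: insubP => [//|_]; apply: contra_neq (loopless e); first by case.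
case: insubP => [j _ vj|/negP[]] //.
case: insubP => [j' _ vj'|] //=.
apply/eqP => -[] /(congr1 val); rewrite /= vj vj' => /eqP.
by rewrite ltn_eqF.
Qed.

Lemma sub_nonempty : (0 < #|sub_vertex|)%N.
Proof. by rewrite card_sum addn_gt0 nonempty. Qed.

Lemma sub_connect_src (e : edge G) k : (k <= l.+1)%N ->
  connect (adjacent sub_src sub_tgt) (inl (src e)) (sub_point e k).
Proof.
elim: k => [|k IH] hk; first exact: connect0.
apply: connect_trans (IH (ltnW hk)) _; apply: connect1; apply/existsP.
by exists (e, Ordinal hk); rewrite /sub_src /sub_tgt /= !eqxx.
Qed.

Lemma sub_connected (x y : sub_vertex) :
  connect (adjacent sub_src sub_tgt) x y.
Proof.
have sym := adjacent_connect_sym sub_src sub_tgt.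
have st e : connect (adjacent sub_src sub_tgt) (inl (src e)) (inl (tgt e)).
  by rewrite -sub_point_max sub_connect_src.
have inlP u v : connect (adjacent sub_src sub_tgt) (inl u) (inl v).
  have /connectP[p] := connected u v.
  elim: p u => [|w p IH] u /=; first by move=> _ ->; exact: connect0.
  case/andP=> /existsP[e he] hp hv; apply: connect_trans (IH w hp hv).
  by case/orP: he => /andP[/eqP<- /eqP<-]; [|rewrite sym].
have toinl z : exists u, connect (adjacent sub_src sub_tgt) z (inl u).
  case: z => [u|[e i]]; first by exists u.
  by exists (src e); rewrite sym -sub_pointS sub_connect_src // ltnW // ltnS.
have [u hu] := toinl x; have [v hv] := toinl y.
by apply: connect_trans hu (connect_trans (inlP u v) _); rewrite sym.
Qed.

Definition subdivision : graph :=
  Graph sub_loopless sub_nonempty sub_connected.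

End Subdivision.

Record metric_graph (R : realType) := MetricGraph {
  model : graph;
  len : edge model -> R;
  len_gt0 : forall e, 0 < len e }.

Section MetricGraph.
Variables (R : realType) (Gamma : metric_graph R).
Local Notation G := (model Gamma).

(* The points are the vertices of the model together with the interior points
   of the edges; (e, t) is at distance t from [src e] along e. *)
Definition interior_point :=
  {x : edge G * R | (0 < x.2) && (x.2 < len x.1)}.
Definition point : choiceType := (vertex G + interior_point)%type.

(* The closed segment [0, len e] -> Gamma; values of t outside that interval
   are irrelevant. *)
Definition segment (e : edge G) (t : R) : point :=
  if insub (e, t) is Some x then inr x
  else if t <= 0 then inl (src e) else inl (tgt e).

(* Affinity is required on *closed* pieces, so this includes continuity. *)
Definition PL_on (a : R) (g : R -> R) : Prop :=
  exists s : seq R,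
    [/\ path <=%R 0 s, last 0 s = a &
        forall i, (i < size s)%N ->
          let t0 := nth 0 (0 :: s) i in let t1 := nth 0 (0 :: s) i.+1 in
          exists c : int, forall t, t0 <= t <= t1 ->
            g t = g t0 + c%:~R * (t - t0)].

(* The edges are glued at the vertices only, so a function on Gamma is
   continuous iff it is continuous along each closed segment. *)
Definition PL (f : point -> R) : Prop :=
  forall e, PL_on (len e) (fun t => f (segment e t)).

(* If g h is the value of f at distance h from p along a tangent direction at
   p, this is the slope of f along that direction, oriented *towards* p.  It
   is well defined when g is affine with integer slope near 0. *)
Definition incoming_slope (g : R -> R) : int :=
  xget 0 [set c : int | exists2 eps : R, 0 < eps &
    forall h, 0 <= h <= eps -> g 0 - g h = c%:~R * h]%classic.

Definition div (f : point -> R) (p : point) : int :=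
  match p with
  | inl v =>
      \sum_(e : edge G | src e == v)
         incoming_slope (fun h => f (segment e h))
    + \sum_(e : edge G | tgt e == v)
         incoming_slope (fun h => f (segment e (len e - h)))
  | inr x =>
      let: (e, t) := val x in
      incoming_slope (fun h => f (segment e (t + h)))
    + incoming_slope (fun h => f (segment e (t - h)))
  end.

Definition metric_equiv (D D' : {freeg point}) : Prop :=
  exists2 f : point -> R, PL f & forall p, coeff p (D - D') = div f p.

End MetricGraph.

Definition metric_gonality (R : realType) (Gamma : metric_graph R) :=
  is_gonality (@metric_equiv R Gamma).
Definition metric_gonality_tight (R : realType) (Gamma : metric_graph R) :=
  gonality_tight (@metric_equiv R Gamma).

Definition unit_metric (R : realType) (G : graph) : metric_graph R :=
  @MetricGraph R G (fun=> 1) (fun=> ltr01).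

Section QuasiBanana.
Local Open Scope nat_scope.
Variables (m : nat) (N : m.-tuple nat) (N_gt0 : all (fun q => 0 < q) N).

(* The cardinality of C_i: 1 for i = 0, and q_i for 1 <= i <= m. *)
Definition layer_size (i : nat) : nat := nth 0 (1 :: N) i.

(* u_{i,j} is [Tagged _ (j - 1)] over the tag i. *)
Definition qb_vertex : finType := {i : 'I_m.+1 & 'I_(layer_size i)}.

(* The number of edges joining x to y, each one being counted for exactly one
   of (x, y) and (y, x): within a layer for increasing second index, between
   consecutive layers from C_i to C_{i+1}. *)
Definition qb_mult (x y : qb_vertex) : nat :=
  let i := tag x : nat in let i' := tag y : nat in
  let j := tagged x : nat in let j' := tagged y : nat in
  if i == i' then if j < j' then 1 else 0
  else if (i' == i.+1) && (j == 0) then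
    \sum_(1 <= k < i.+1) layer_size k + 2
  else 0.

Definition qb_edge : finType :=
  {p : qb_vertex * qb_vertex & 'I_(qb_mult p.1 p.2)}.
Definition qb_src (e : qb_edge) : qb_vertex := (tag e).1.
Definition qb_tgt (e : qb_edge) : qb_vertex := (tag e).2.

Lemma qb_loopless e : qb_src e != qb_tgt e.
Proof.
case: e => -[x y] /= [k]; apply: contraTneq; rewrite /qb_src /qb_tgt /= => ->.
by rewrite /qb_mult eqxx ltnn.
Qed.

Lemma layer_size_gt0 i : i < m.+1 -> 0 < layer_size i.
Proof.
case: i => [|i] //=; rewrite ltnS => hi.
by apply: (allP N_gt0 (nth 0 N i)); rewrite mem_nth // size_tuple.
Qed.

Definition qb_root : qb_vertex :=
  Tagged (fun i : 'I_m.+1 => 'I_(layer_size i))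
    (Ordinal (layer_size_gt0 (ltn_ord (@ord0 m)))).

Lemma qb_nonempty : 0 < #|qb_vertex|.
Proof. by apply/card_gt0P; exists qb_root. Qed.

Lemma qb_adjacent x y : 0 < qb_mult x y -> adjacent qb_src qb_tgt x y.
Proof.
move=> h; apply/existsP.
exists (Tagged (fun p => 'I_(qb_mult p.1 p.2)) (Ordinal h : 'I_(qb_mult (x, y).1 (x, y).2))).
by rewrite /qb_src /qb_tgt /= !eqxx.
Qed.

Lemma qb_connected x y : connect (adjacent qb_src qb_tgt) x y.
Proof.
have sym := adjacent_connect_sym qb_src qb_tgt.
suff H z : connect (adjacent qb_src qb_tgt) qb_root z.
  by apply: connect_trans (H y); rewrite sym.
case: z => -[i hi]; elim: i hi => [|i IH] hi j.
  suff -> : existT (fun i : 'I_m.+1 => 'I_(layer_size i)) (Ordinal hi) j = qb_root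
    by exact: connect0.
  rewrite /qb_root /Tagged; have e : Ordinal hi = ord0 by exact: val_inj.
  case: _ / e j => j; congr existT; apply: val_inj => /=.
  by case: j => -[|j] //=.
have hi' := ltnW hi.
apply: connect_trans (IH hi' (Ordinal (layer_size_gt0 hi'))) _.
apply: connect1; apply: qb_adjacent; rewrite /qb_mult /= eqxx /=.
by rewrite (ltn_eqF (ltnSn i)) addn2.
Qed.

Definition QB : graph := Graph qb_loopless qb_nonempty qb_connected.

End QuasiBanana.

Definition quasi_banana (G : graph) : Prop :=
  exists (m : nat) (N : m.-tuple nat) (N_gt0 : all (fun q => 0 < q)%N N),
    isomorphic G (QB N_gt0).

(* Main.v *)
From Stdlib Require Import Relation_Operators.
From mathcomp Require Import all_boot all_order all_algebra.
From mathcomp Require Import zify ring lra.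
From mathcomp Require Import boolp classical_sets reals.
From mathcomp.multinomials Require Import freeg.
Require Import Defs.

Set Implicit Arguments.
Unset Strict Implicit.
Unset Printing Implicit Defensive.

Import Order.TTheory GRing.Theory Num.Theory.

Local Open Scope ring_scope.

(** Let [n] be the number of vertices of the quasi-banana graph [G], that is
    1 + q_1 + ... + q_m.  The graph [G], all its subdivisions and the metric
    graph have first gonality [n] and second gonality [n + 1].  One computation
    on the vertices of [G] serves all three.

    A criterion on the vertices.  Subdivisions and the metric graph have the
    same picture: chips at the vertices of [G] and chips inside its edges.  For
    a dart [a] (an edge with a direction) let [M a] be the sum, over the chips
    inside the edge, of the distance to the end of [a].  When a firing script
    leads from [D] to an effective divisor, its potential is convex along each
    edge except for bends paid for by chips of [D].  Hence a potential with
    values [f] at the vertices gives to [dsrc a], along [a], at most the integer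
    part of f (dtgt a) - f (dsrc a) + M a chips; and for each edge there is a
    potential that attains this bound at both ends, leaving at most one chip
    inside.  So [D] is equivalent to an effective divisor if and only if some
    real function [f] on the vertices satisfies [settles]: this is
    [graph_effectiveP], [sub_effectiveP] and [metric_effectiveP].  What remains
    is combinatorics of finitely many floors.

    Rank.  The functions that settle a divisor are closed under maximum.  Moving
    between a function that brings a chip to one end of an edge and a function
    that brings one to the other end shows that a chip can be brought to every
    point of that edge ([solvable_interior]), so the rank can be tested on the
    vertices of [G] only.

    The divisor of degree [n + 1].  Put one chip on each vertex and a second one
    on the root.  Starting from the pile on a hub, firing everything except a
    vertex [v] of the next layer and what hangs above [v] collects on [v] all
    chips of the layers up to its own and leaves the higher layers untouched.
    Iterating this reaches every pair of vertices ([spread_solvable]).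

    The bound.  Suppose that [D] can bring a chip to each vertex.  The first
    vertices of the layers, the hubs, are cut vertices; among the divisors
    equivalent to [D] take one that has sent as many chips as possible downwards
    through the hubs ([descent]).  Then no potential sends further chips down to
    a hub ([descent_le0]).  Let [w] be in layer j + 1.  If [w] can
    only be reached by a potential lower at [w] than at the hub of layer j, a
    level set separates [w] from that hub, and its boundary, of size at least
    1 + q_1 + ... + q_(j+1), is paid for by the chips of the layers up to j + 1
    ([chips_upto_hub_lt]).  If no such [w] exists, layer j + 1 holds at least
    q_(j+1) chips of its own ([chips_block]).  By induction there are at least
    1 + q_1 + ... + q_j chips up to layer j ([chips_upto_ge], [degree_ge]). *)

(** * Edges with a direction *)
Section Darts.
Variable G : graph.

(** The boolean tells whether the edge is travelled from [src] to [tgt]; sums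
    over the darts that leave a vertex replace the pairs of sums over the edges
    oriented out of it and into it. *)
Definition dart : finType := (edge G * bool)%type.
Definition dsrc (a : dart) : vertex G := if a.2 then src a.1 else tgt a.1.
Definition dtgt (a : dart) : vertex G := if a.2 then tgt a.1 else src a.1.
Definition drev (a : dart) : dart := (a.1, ~~ a.2).

Lemma drevK : involutive drev.
Proof. by case=> e b; rewrite /drev /= negbK. Qed.

Lemma dsrc_rev a : dsrc (drev a) = dtgt a.
Proof. by case: a => e []. Qed.

Lemma dtgt_rev a : dtgt (drev a) = dsrc a.
Proof. by case: a => e []. Qed.

Lemma dsrc_neq_dtgt a : dsrc a != dtgt a.
Proof. by case: a => e [] /=; rewrite /dsrc /dtgt /= ?loopless // eq_sym loopless. Qed.

Lemma sum_dart (A : nmodType) (F : dart -> A) :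
  \sum_a F a = \sum_e (F (e, true) + F (e, false)).
Proof.
transitivity (\sum_e \sum_b F (e, b)); last first.
  by apply: eq_bigr => e _; rewrite big_bool.
by rewrite pair_bigA; apply: eq_bigr => -[].
Qed.

Lemma sum_dsrc (A : nmodType) (F : dart -> A) :
  \sum_x \sum_(a | dsrc a == x) F a = \sum_a F a.
Proof. by rewrite (partition_big dsrc xpredT). Qed.

Lemma sum_dsrc_in (A : nmodType) (S : pred (vertex G)) (F : dart -> A) :
  \sum_(x | S x) \sum_(a | dsrc a == x) F a = \sum_(a | S (dsrc a)) F a.
Proof.
rewrite (partition_big dsrc S) //=; apply: eq_bigr => x Sx.
by apply: eq_bigl => a; case: eqP => [->|]; rewrite ?Sx ?andbF.
Qed.

Lemma sum_drev (A : nmodType) (P : pred dart) (F : dart -> A) :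
  \sum_(a | P a) F a = \sum_(a | P (drev a)) F (drev a).
Proof. by rewrite (reindex_inj (inv_inj drevK)). Qed.

Lemma sum_dsrcE (A : nmodType) (F : dart -> A) x :
  \sum_(a | dsrc a == x) F a =
  \sum_(e | src e == x) F (e, true) + \sum_(e | tgt e == x) F (e, false).
Proof.
rewrite big_mkcond sum_dart big_split /=.
by congr (_ + _); rewrite [RHS]big_mkcond.
Qed.

End Darts.

(** * The vertex criterion and its tropical convexity *)
Section Criterion.
Variables (R : archiRealFieldType) (G : graph).
Implicit Types (D : vertex G -> int) (M : dart G -> R) (f g : vertex G -> R).

(** The number of chips that [dsrc a] receives along [a] when the potential is
    [f] at the vertices and as favourable as possible inside the edge.  Here
    [M a] is the sum of the distances from the chips inside the edge to the end
    of [a]; it lifts the far end of the edge by as much as those chips allow. *)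
Definition gain M f (a : dart G) : int :=
  Num.floor (f (dtgt a) - f (dsrc a) + M a).

Definition chips D M f (x : vertex G) : int :=
  D x + \sum_(a | dsrc a == x) gain M f a.

Definition settles D M f := forall x, 0 <= chips D M f x.

Definition solvable D M := exists f, settles D M f.

Lemma gain_le M f (a : dart G) (M' : dart G -> R) g :
  f (dtgt a) - f (dsrc a) + M a <= g (dtgt a) - g (dsrc a) + M' a ->
  gain M f a <= gain M' g a.
Proof. exact: le_floor. Qed.

Lemma gain_shift M f c (a : dart G) : gain M (fun x => f x + c) a = gain M f a.
Proof. by rewrite /gain opprD addrACA subrr addr0. Qed.

Lemma chips_shift D M f c x : chips D M (fun x => f x + c) x = chips D M f x.
Proof. by congr (_ + _); apply: eq_bigr => a _; exact: gain_shift. Qed.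

Lemma gain_rev M f (a : dart G) (d : int) :
  M a + M (drev a) = d%:~R -> gain M f a + gain M f (drev a) <= d.
Proof.
rewrite /gain dsrc_rev dtgt_rev => Md; rewrite -(ler_int R) intrD.
have := floor_le (f (dtgt a) - f (dsrc a) + M a).
have := floor_le (f (dsrc a) - f (dtgt a) + M (drev a)).
by lra.
Qed.

(** Within [S] the two floors of an edge add up to at most the number of chips
    inside that edge, so all other chips come in through darts leaving [S]. *)
Lemma sum_chips_le D M (d : edge G -> int) f (S : pred (vertex G)) :
    (forall e, M (e, true) + M (e, false) = (d e)%:~R) ->
  \sum_(x | S x) chips D M f x <=
  \sum_(x | S x) D x + \sum_(e | S (src e) && S (tgt e)) d e +
  \sum_(a | S (dsrc a) && ~~ S (dtgt a)) gain M f a.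
Proof.
move=> Md; rewrite big_split /= sum_dsrc_in -addrA lerD2l.
rewrite (bigID (fun a => S (dtgt a))) /= lerD2r.
rewrite big_mkcond sum_dart [leRHS]big_mkcond /=; apply: ler_sum => e _.
rewrite /dsrc /dtgt /= andbC; case: ifP => _; last by rewrite addr0.
by apply: (@gain_rev M f (e, true)); rewrite Md.
Qed.

Lemma sum_chips D M f :
  \sum_x chips D M f x =
  \sum_x D x + \sum_e (gain M f (e, true) + gain M f (e, false)).
Proof. by rewrite big_split /= sum_dsrc sum_dart. Qed.

Lemma chips_le_max D M f g x :
  f x = g x -> (forall y, f y <= g y) -> chips D M f x <= chips D M g x.
Proof.
move=> fx fg; rewrite lerD2l; apply: ler_sum => a /eqP ax.
by apply: gain_le; rewrite ax fx lerD2r lerD2r.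
Qed.

(** At a vertex where the maximum is [f], the neighbours are at least as high as
    under [f] alone, so no chip is lost. *)
Lemma settles_max D M f g :
  settles D M f -> settles D M g -> settles D M (fun x => Num.max (f x) (g x)).
Proof.
move=> Rf Rg x; case: (leP (g x) (f x)) => h.
  apply: le_trans (Rf x) (chips_le_max _ _ _ _) => [|y]; first by rewrite max_l.
  by rewrite le_max lexx.
apply: le_trans (Rg x) (chips_le_max _ _ _ _) => [|y]; first by rewrite max_r // ltW.
by rewrite le_max lexx orbT.
Qed.

End Criterion.

(** * The vertices determine the rank *)
Section InteriorChip.
Variables (R : archiRealFieldType) (G : graph).
Implicit Types (D : vertex G -> int) (M : dart G -> R) (f g : vertex G -> R).

Definition chip (v x : vertex G) : int := (x == v)%:R.

(** The contribution to [M] of a chip on [e] at distance [t] from [src e], the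
    edges having length 1. *)
Definition moment (e : edge G) (t : R) (a : dart G) : R :=
  if a.1 == e then if a.2 then 1 - t else t else 0.

Definition chips_off D M f (a0 : dart G) : int :=
  D (dsrc a0) + \sum_(a | (dsrc a == dsrc a0) && (a != a0)) gain M f a.

Lemma chips_offE D M f a0 :
  chips D M f (dsrc a0) = chips_off D M f a0 + gain M f a0.
Proof. by rewrite /chips (bigD1 a0) //= /chips_off -addrA [X in _ + X]addrC. Qed.

Lemma chips_off_le D M f g a0 :
    f (dsrc a0) = g (dsrc a0) -> (forall y, f y <= g y) ->
  chips_off D M f a0 <= chips_off D M g a0.
Proof.
move=> fg0 fg; rewrite lerD2l; apply: ler_sum => a /andP[/eqP ax _].
by apply: gain_le; rewrite ax fg0 lerD2r lerD2r.
Qed.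

Lemma settles_interior D M e t f :
    (forall z, z != src e -> z != tgt e -> 0 <= chips D M f z) ->
    0 <= chips_off D M f (e, true) +
         Num.floor (f (tgt e) - f (src e) + M (e, true) - (1 - t)) ->
    0 <= chips_off D M f (e, false) +
         Num.floor (f (src e) - f (tgt e) + M (e, false) - t) ->
  settles D (fun a => M a - moment e t a) f.
Proof.
set M' := fun a => _ => Hz Hx Hy z.
have off a0 : a0.1 = e -> chips_off D M' f a0 = chips_off D M f a0.
  move=> a0e; congr (_ + _); apply: eq_bigr => a /andP[/eqP az aa0].
  rewrite /gain /M' /moment; case: eqP => [ae|_]; last by rewrite subr0.
  suff : dsrc a = dtgt a0.
    by move/eqP; rewrite az (negPf (dsrc_neq_dtgt a0)).
  by case: a a0 ae a0e aa0 {az} => [? []] [? []] /= -> ->; rewrite ?eqxx.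
have [->|zx] := eqVneq z (src e).
  rewrite (chips_offE D M' f (e, true)) off // /gain /M' /moment eqxx /=.
  by rewrite addrA.
have [->|zy] := eqVneq z (tgt e).
  rewrite (chips_offE D M' f (e, false)) off // /gain /M' /moment eqxx /=.
  by rewrite addrA.
apply: le_trans (Hz z zx zy) _; rewrite lerD2l; apply: ler_sum => a /eqP az.
apply: gain_le; rewrite /M' /moment; case: eqP => [ae|_]; last by rewrite subr0.
by case: a az ae zx zy => e' [] /= <- <-; rewrite ?eqxx.
Qed.

(** Let [fx] and [fy] bring a chip to the ends [x] and [y] of [e].  As [c] varies,
    the maxima of [fx] and [fy + c] interpolate between the two.  If [fx] rises
    from [x] to [y] no more than [fy] does, some maximum agrees with [fx] at [x]
    and with [fy + c] at [y], hence has a chip at both ends, and these two chips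
    move inwards, one to the given point and the other to its mirror image.  If
    it rises more, the difference of [fx] and [fy] carries chips along [e], and
    either one of them can be stopped at the given point, or that point is close
    enough to an end for [fx] or [fy] alone. *)
Lemma solvable_interior D M e t (d : int) :
    M (e, true) + M (e, false) = d%:~R -> 0 <= t <= 1 ->
    solvable (fun x => D x - chip (src e) x) M ->
    solvable (fun x => D x - chip (tgt e) x) M ->
  solvable D (fun a => M a - moment e t a).
Proof.
move=> Md /andP[t0 t1] [fx Rx] [fy0 Ry0].
pose x := src e; pose y := tgt e.
have chipsB D' v f z : chips (fun x => D' x - chip v x) M f z =
    chips D' M f z - (z == v)%:R.
  by rewrite /chips /chip addrAC.
have chx : 1 <= chips D M fx x.
  by have := Rx x; rewrite chipsB eqxx subr_ge0.
have chy c : 1 <= chips D M (fun z => fy0 z + c) y.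
  by have := Ry0 y; rewrite chipsB eqxx subr_ge0 chips_shift.
have Sx : settles D M fx.
  by move=> z; have := Rx z; rewrite chipsB subr_ge0; apply: le_trans.
have Sy c : settles D M (fun z => fy0 z + c).
  move=> z; have := Ry0 z; rewrite chipsB subr_ge0 chips_shift.
  exact: le_trans.
set m0 := M (e, true) in Md *; set m1 := M (e, false) in Md *.
have floorB1 (r s : R) : 0 <= s <= 1 -> Num.floor r <= Num.floor (r - s) + 1.
  move=> /andP[s0 s1]; rewrite -lerBlDr floor_ge_int intrB.
  by have := floor_le r; lra.
have t'01 : 0 <= 1 - t <= 1 by apply/andP; split; lra.
have t01 : 0 <= t <= 1 by rewrite t0 t1.
have offx f : chips D M f x = chips_off D M f (e, true) +
    Num.floor (f y - f x + m0) by exact: (chips_offE D M f (e, true)).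
have offy f : chips D M f y = chips_off D M f (e, false) +
    Num.floor (f x - f y + m1) by exact: (chips_offE D M f (e, false)).
have offlex f g : f x = g x -> (forall z, f z <= g z) ->
    chips_off D M f (e, true) <= chips_off D M g (e, true).
  by move=> fg; apply: chips_off_le.
have offley f g : f y = g y -> (forall z, f z <= g z) ->
    chips_off D M f (e, false) <= chips_off D M g (e, false).
  by move=> fg; apply: chips_off_le.
pose dx := fx y - fx x; pose dy := fy0 y - fy0 x.
pose fy c z := fy0 z + c; pose f c z := Num.max (fx z) (fy c z).
have fxlef c z : fx z <= f c z by rewrite le_max lexx.
have fylef c z : fy c z <= f c z by rewrite le_max lexx orbT.
have Sf c : settles D M (f c) by exact: (settles_max Sx (Sy c)).
have [le_xy|lt_yx] := leP dx dy.
  pose c := fx x - fy0 x.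
  have fxx : fx x = f c x by rewrite /f /fy /c max_l // [fy0 x + _]addrC subrK.
  have fyy : fy c y = f c y.
    by rewrite /f max_r //; move: le_xy; rewrite /fy /c /dx /dy => ?; lra.
  exists (f c); apply: settles_interior => [z _ _||]; first exact: Sf.
    rewrite -/x -/y -/m0; have := le_trans chx (chips_le_max _ _ fxx (fxlef c)).
    by rewrite offx; have := floorB1 (f c y - f c x + m0) (1 - t) t'01; lra.
  rewrite -/x -/y -/m1; have := le_trans (chy c) (chips_le_max _ _ fyy (fylef c)).
  by rewrite offy; have := floorB1 (f c x - f c y + m1) t t01; lra.
pose a := dx + m0; pose b := dy + m0.
have day : fx x - fx y + m1 = d%:~R - a by rewrite /a /dx -Md; ring.
have dbx : fy0 y - fy0 x + m0 = b by [].
have ba : b < a by rewrite ltrD2r.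
have flb := floor_itv b.
(* [a] and [b] are the arguments of the floor at [x] for [fx] and [fy]; they lie
   in the same unit interval here, and the chip that [fx] brings to [x] can be
   pushed inwards at no cost for [y] *)
have [a_lt|a_ge] := ltP a ((Num.floor b)%:~R + (1 - t)).
  exists fx; apply: settles_interior => [z _ _||]; first exact: Sx.
    rewrite -/x -/y -/m0; move: chx; rewrite offx.
    by have := floorB1 (fx y - fx x + m0) (1 - t) t'01; lra.
  rewrite -/x -/y -/m1; have := Sx y; rewrite offy day => /le_trans; apply.
  rewrite lerD2l floor_ge_int.
  suff : Num.floor (d%:~R - a) <= d - Num.floor b - 1.
    rewrite -(ler_int R) !intrD !mulrNz; lra.
  rewrite -ltzD1 floor_lt_int !intrD !mulrNz; lra.
(* likewise for the chip that [fy] brings to [y] *)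
have [b_gt|b_le] := ltP ((Num.floor b)%:~R + (1 - t)) b.
  exists (fun z => fy0 z + 0); apply: settles_interior => [z _ _||].
  - exact: Sy.
  - rewrite -/x -/y -/m0; have := Sy 0 x; rewrite offx !addr0 dbx => /le_trans; apply.
    by rewrite lerD2l floor_ge_int; lra.
  rewrite -/x -/y -/m1; have := chy 0; rewrite offy.
  by have := floorB1 (fy0 x + 0 - (fy0 y + 0) + m1) t t01; lra.
(* [s] lies between [b] and [a]; the shift is chosen so that the argument of the
   floor at [x] is [s], which puts the travelling chip exactly at distance [t] *)
pose s := (Num.floor b)%:~R + (1 - t).
pose c := fx y - fy0 x - (s - m0).
have fx_y : fx y = f c y.
  by rewrite /f max_l //; move: b_le; rewrite /fy /c /s /b /dy => ?; lra.
have fy_x : fy c x = f c x.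
  by rewrite /f max_r //; move: a_ge; rewrite /fy /c /s /a /dx => ?; lra.
have sE : f c y - f c x = s - m0 by rewrite -fx_y -fy_x /fy /c; ring.
exists (f c); apply: settles_interior => [z _ _||]; first exact: Sf.
  rewrite -/x -/y -/m0 sE subrK /s addrK intrKfloor.
  have := Sy c x; rewrite offx; have := offlex (fy c) (f c) fy_x (fylef c).
  have -> : fy0 y + c - (fy0 x + c) + m0 = b by rewrite /b /dy; ring.
  lra.
rewrite -/x -/y -/m1 -[f c x - f c y]opprB sE.
have -> : - (s - m0) + m1 - t = (d - Num.floor b - 1)%:~R.
  by rewrite !intrD !mulrNz -Md /s; ring.
rewrite intrKfloor; have := Sx y; rewrite offy day.
have := offley fx (f c) fx_y (fxlef c).
suff : Num.floor (d%:~R - a) <= d - Num.floor b - 1 by lra.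
rewrite -ltzD1 floor_lt_int !intrD !mulrNz; lra.
Qed.

End InteriorChip.

(** * Layers and hubs *)
Section Layers.
Local Open Scope nat_scope.
Variable G : graph.

Definition mult (x y : vertex G) : nat :=
  \sum_(a : dart G | (dsrc a == x) && (dtgt a == y)) 1.

Lemma multC x y : mult x y = mult y x.
Proof.
rewrite /mult sum_drev; apply: eq_bigl => a.
by rewrite dsrc_rev dtgt_rev andbC.
Qed.

Variables (m : nat) (lay : vertex G -> nat) (hub : nat -> vertex G).

(** Layer 0 is left out, as in the multiplicities of a quasi-banana graph. *)
Definition below (i : nat) : nat := \sum_(1 <= k < i.+1) #|[pred x | lay x == k]|.

(** The shape of a quasi-banana graph, in terms invariant under isomorphism.
    Since [mult] is symmetric, [mult_up] and [mult_far] also describe the edges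
    towards lower layers. *)
Record layered : Prop := Layered {
  lay_le : forall x, lay x <= m;
  lay_hub : forall i, i <= m -> lay (hub i) = i;
  lay0_hub : forall x, lay x = 0 -> x = hub 0;
  mult_layer : forall x y, x != y -> lay x = lay y -> mult x y = 1;
  mult_up : forall x y, lay y = (lay x).+1 ->
    mult x y = if x == hub (lay x) then below (lay x) + 2 else 0;
  mult_far : forall x y, (lay x).+1 < lay y -> mult x y = 0 }.

Lemma belowS i : below i.+1 = below i + #|[pred x | lay x == i.+1]|.
Proof. by rewrite /below big_nat_recr. Qed.

Hypothesis HG : layered.

Lemma dart_mult (a : dart G) : 0 < mult (dsrc a) (dtgt a).
Proof. by rewrite /mult (bigD1 a) //= !eqxx. Qed.

Lemma dart_up_le a : lay (dtgt a) <= (lay (dsrc a)).+1.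
Proof. by rewrite leqNgt; apply/negP => /(mult_far HG) h; have := dart_mult a; rewrite h. Qed.

Lemma dart_down_le a : lay (dsrc a) <= (lay (dtgt a)).+1.
Proof. by rewrite -dtgt_rev -(dsrc_rev a) dart_up_le. Qed.

Lemma dart_up_hub a : lay (dtgt a) = (lay (dsrc a)).+1 -> dsrc a = hub (lay (dsrc a)).
Proof.
by move=> /(mult_up HG) h; have := dart_mult a; rewrite h; case: eqP.
Qed.

Lemma dart_down_hub a : lay (dsrc a) = (lay (dtgt a)).+1 -> dtgt a = hub (lay (dtgt a)).
Proof. by rewrite -(dsrc_rev a) -(dtgt_rev a); exact: dart_up_hub. Qed.

Lemma sum_mult (S T : pred (vertex G)) :
  \sum_(a : dart G | S (dsrc a) && T (dtgt a)) 1 =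
  \sum_(y | T y) \sum_(x | S x) mult x y.
Proof.
rewrite exchange_big (partition_big (@dsrc G) S) /=; last by move=> a /andP[].
apply: eq_bigr => x Sx; rewrite (partition_big (@dtgt G) T) /=; last first.
  by move=> a /andP[/andP[]].
apply: eq_bigr => y Ty; apply: eq_bigl => a.
by case: eqP => [->|]; case: eqP => [->|]; rewrite ?andbF ?andbT //= Sx Ty.
Qed.

(** With k vertices in [Z] and q in the layer, the number of separating edges is
    k (below i + 2 + q - k), concave in k and hence smallest at k = 1. *)
Lemma cut_layer i (Z : pred (vertex G)) z :
    Z z -> (forall x, Z x -> lay x = i.+1) ->
  below i.+1 + 1 <= \sum_(a : dart G |
    ((dsrc a == hub i) || ((lay (dsrc a) == i.+1) && ~~ Z (dsrc a))) &&
    Z (dtgt a)) 1.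
Proof.
move=> Zz Zi; have im : i < m by rewrite -(Zi _ Zz) (lay_le HG).
have hubi : lay (hub i) = i by rewrite (lay_hub HG) // ltnW.
have -> := sum_mult (fun x => (x == hub i) || ((lay x == i.+1) && ~~ Z x)) Z.
pose k := #|Z|; pose q := #|[pred x | lay x == i.+1]|.
have k_gt0 : 0 < k by apply/card_gt0P; exists z.
have k_q : k <= q by apply/subset_leq_card/fintype.subsetP => x /Zi /eqP.
rewrite (eq_bigr (fun _ => below i + 2 + (q - k))) => [|y Zy]; last first.
  rewrite (bigD1 (hub i)) ?eqxx //= (mult_up HG); last by rewrite hubi Zi.
  rewrite hubi eqxx; congr (_ + _).
  rewrite (eq_bigr (fun _ => 1)) => [|x /andP[/orP[/eqP->|/andP[/eqP xi Zx] _]]].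
  - rewrite sum1_card -[q - k]/(#|_| - #|_|).
    rewrite -[#|[pred x | lay x == i.+1]|](cardID Z).
    rewrite (_ : #|[predI _ & Z]| = k) ?addKn; last first.
      by apply: eq_card => x; rewrite !inE /in_mem /=; case Zx: (Z x); rewrite ?andbF // (Zi _ Zx) eqxx.
    apply: eq_card => x; rewrite !inE /in_mem /=.
    have [->|] := eqVneq x (hub i); rewrite ?andbF ?andbT //=.
      by rewrite hubi [i == _]ltn_eqF // andbF.
    by rewrite andbC.
  - by rewrite eqxx.
  apply: (mult_layer HG); last by rewrite xi Zi.
  by apply: contraNneq Zx => ->.
rewrite sum_nat_const belowS -/q -[#|_|]/k.
by case: k k_gt0 k_q => // k' _ k_q; nia.
Qed.

End Layers.

(** * Divisors that reach every vertex *)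
Section LowerBound.
Variables (R : archiRealFieldType) (G : graph).
Variables (m : nat) (lay : vertex G -> nat) (hub : nat -> vertex G).
Hypothesis HG : layered m lay hub.
Implicit Types (f g : vertex G -> R) (i j : nat).

Local Notation below := (below lay).

(** The chips that the hub of layer [i] receives from layer [i.+1]. *)
Definition descent (M : dart G -> R) i f : int :=
  \sum_(a | (lay (dsrc a) == i) && (lay (dtgt a) == i.+1)) gain M f a.

(** Only the hub of a layer has neighbours in the next layer. *)
Lemma chips_split (D : vertex G -> int) M f x :
  chips D M f x =
  D x + \sum_(a | (dsrc a == x) && (lay (dtgt a) <= lay x)%N) gain M f a +
  (if x == hub (lay x) then descent M (lay x) f else 0).
Proof.
rewrite -addrA /chips (bigID (fun a => lay (dtgt a) <= lay x)%N) /=.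
congr (_ + (_ + _)); case: eqP => [xh|xnh].
  apply: eq_bigl => a; rewrite -ltnNge; apply/andP/andP => -[/eqP h1 h2].
    by rewrite h1 eqxx eqn_leq h2 andbT; have := dart_up_le HG a; rewrite h1.
  by split; rewrite ?(eqP h2) // (dart_up_hub HG) h1 ?(eqP h2) // -xh.
rewrite big_pred0 // => a; apply/negbTE/negP => /andP[/eqP ax]; rewrite -ltnNge => h.
case: xnh; rewrite -{1}ax (dart_up_hub HG) ax //.
by apply/eqP; rewrite eqn_leq h andbT; have := dart_up_le HG a; rewrite ax.
Qed.

(** Hubs are cut vertices, so a potential may be replaced by a constant below
    the hub of layer [i] and above the hub of layer [i.+1]; only the chips of the
    block between these two hubs still move. *)
Definition block_part i f (x : vertex G) : R :=
  if (lay x <= i)%N then f (hub i)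
  else if (lay x <= i.+1)%N then f x else f (hub i.+1).

(** The situation after the choice of an extremal divisor: [D] is effective, no
    edge has more than one interior chip, and the zero function maximises the
    total descent. *)
Section Reduced.
Variables (D : vertex G -> int) (M : dart G -> R) (d : edge G -> int).
Hypothesis Md : forall e, M (e, true) + M (e, false) = (d e)%:~R.
Hypothesis M01 : forall a, 0 <= M a < 1.
Hypothesis D_ge0 : forall x, 0 <= D x.
Hypothesis descent_max : forall f, settles D M f -> \sum_(i < m) descent M i f <= 0.

Lemma gain_flat f (a : dart G) : f (dtgt a) = f (dsrc a) -> gain M f a = 0.
Proof.
move=> h; rewrite /gain h subrr add0r; apply/eqP.
by rewrite floor_eq add0r; have := M01 a.
Qed.

Lemma gain_up_ge0 f (a : dart G) : f (dsrc a) <= f (dtgt a) -> 0 <= gain M f a.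
Proof.
by move=> h; rewrite /gain floor_ge0; have /andP[h1 _] := M01 a; lra.
Qed.

Lemma d_ge0 e : 0 <= d e.
Proof.
rewrite -(ler_int R) -Md.
by have /andP[h1 _] := M01 (e, true); have /andP[h2 _] := M01 (e, false); lra.
Qed.

(** Downhill an edge loses a chip, unless the chip inside the edge replaces it. *)
Lemma gain_down_lt f (a : dart G) : f (dtgt a) < f (dsrc a) -> gain M f a <= d a.1 - 1.
Proof.
move=> h; have /andP[h1 h2] := M01 a; have /andP[h3 h4] := M01 (drev a).
rewrite -ltzD1 subrK floor_lt_int.
have Mda : M a + M (drev a) = (d a.1)%:~R.
  by rewrite -Md; case: a {h h1 h2 h3 h4} => e [] //; rewrite addrC.
by rewrite -Mda; lra.
Qed.

Lemma descent_block_part i f : descent M i (block_part i f) = descent M i f.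
Proof.
apply: eq_bigr => a /andP[/eqP ai /eqP ai1].
have {ai1} ai1 : lay (dtgt a) = (lay (dsrc a)).+1 by rewrite ai.
by rewrite /gain /block_part ai1 ai leqnn ltnn leqnn (dart_up_hub HG ai1) ai.
Qed.

Lemma block_part_flat i f a :
    (lay (dsrc a) <= i)%N && (lay (dtgt a) <= i)%N
    || (i < lay (dsrc a))%N && (i.+1 < lay (dtgt a))%N
    || (i.+1 < lay (dsrc a))%N && (i < lay (dtgt a))%N ->
  block_part i f (dtgt a) = block_part i f (dsrc a).
Proof.
rewrite /block_part => h.
have up := dart_up_le HG a; have down := dart_down_le HG a.
case: (leqP (lay (dtgt a)) i) h => ti; case: (leqP (lay (dsrc a)) i) => si //= h;
  try by exfalso; lia.
case: (leqP (lay (dtgt a)) i.+1) h => ti1; case: (leqP (lay (dsrc a)) i.+1) => si1 //= h.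
  have ts : lay (dsrc a) = (lay (dtgt a)).+1 by lia.
  by rewrite (dart_down_hub HG ts); congr (f (hub _)); lia.
have ts : lay (dtgt a) = (lay (dsrc a)).+1 by lia.
by rewrite (dart_up_hub HG ts); congr (f (hub _)); lia.
Qed.

Lemma descent_block_part_ne i j f : j != i -> descent M j (block_part i f) = 0.
Proof.
move=> ji; apply: big1 => a /andP[/eqP aj /eqP aj1]; apply: gain_flat.
by apply: block_part_flat; rewrite aj aj1; lia.
Qed.

(** Making [f] flat above the hub of layer [i.+1] can only help that hub, which
    would receive nothing from above anyway. *)
Lemma chips_block_part i f x : (i <= m)%N -> descent M i.+1 f <= 0 ->
  (if (lay x <= i)%N then D x + (if x == hub i then descent M i f else 0)
   else if (lay x <= i.+1)%N then chips D M f x else D x)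
  <= chips D M (block_part i f) x.
Proof.
move=> im le0; have [xi|xi] := leqP (lay x) i.
  rewrite chips_split big1 ?addr0 => [|a /andP[/eqP ax ha]]; last first.
    by apply: gain_flat; apply: block_part_flat; rewrite ax xi (leq_trans ha).
  rewrite lerD2l; case: (eqVneq (lay x) i) => [->|xi_ne].
    by rewrite descent_block_part.
  rewrite descent_block_part_ne // if_same.
  by case: (x =P hub i) xi_ne => [->|//]; rewrite (lay_hub HG) // eqxx.
have [xi1|xi1] := leqP (lay x) i.+1.
  rewrite !chips_split lerD //.
    rewrite lerD2l; apply: ler_sum => a /andP[/eqP ax ha]; apply: gain_le.
    have down := dart_down_le HG a; rewrite ax in down.
    have -> : block_part i f (dtgt a) = f (dtgt a).
      rewrite /block_part (leq_trans ha xi1); case: leqP => // ti.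
      have ts : lay (dsrc a) = (lay (dtgt a)).+1 by rewrite ax; lia.
      by rewrite (dart_down_hub HG ts); congr (f (hub _)); lia.
    by rewrite ax /block_part (leqNgt (lay x)) xi xi1.
  have -> : lay x = i.+1 by lia.
  by rewrite descent_block_part_ne ?eqn_leq ?ltnn //; case: ifP.
rewrite /chips big1 ?addr0 // => a /eqP ax; apply: gain_flat; apply: block_part_flat.
by rewrite ax; have := dart_down_le HG a; rewrite ax; lia.
Qed.


Lemma chips_ge_floor f c x : f x = c -> (forall y, c <= f y) -> 0 <= chips D M f x.
Proof.
move=> fx cf; apply: le_trans (D_ge0 x) _; rewrite lerDl; apply: sumr_ge0 => a /eqP ax.
by apply: gain_up_ge0; rewrite ax fx.
Qed.

(** By downward induction on [i]: if the layers above [i.+1] send nothing down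
    and layer [i.+1] sends something to layer [i], the restriction of [f] to this
    block settles [D] and has positive total descent. *)
Lemma descent_le0 f i : settles D M f -> descent M i f <= 0.
Proof.
move=> Rf; have [n] : exists n, (m <= i + n)%N by exists m; rewrite leq_addl.
elim: n i => [|n IH] i mi.
  rewrite addn0 in mi; rewrite /descent big_pred0 // => a; apply/negbTE/negP.
  by move=> /andP[_ /eqP h]; have := lay_le HG (dtgt a); rewrite h; lia.
have {IH} IH : descent M i.+1 f <= 0 by apply: IH; rewrite addSnnS.
have [mi0|im] := leqP m i.
  rewrite /descent big_pred0 // => a; apply/negbTE/negP.
  by move=> /andP[_ /eqP h]; have := lay_le HG (dtgt a); rewrite h; lia.
rewrite leNgt; apply/negP => pos.
suff /descent_max : settles D M (block_part i f).
  rewrite (bigD1 (Ordinal im)) //= big1 => [|j ji].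
    by rewrite descent_block_part addr0 leNgt pos.
  by apply: descent_block_part_ne.
move=> x; apply: le_trans (chips_block_part x (ltnW im) IH).
case: ifP => // _; first by rewrite addr_ge0 //; case: ifP => // _; rewrite ltW.
by case: ifP => // _; exact: D_ge0.
Qed.

(** Firing an upper level set costs a chip for each boundary edge.  The chips
    come from the set itself or from inside the edges that meet it; those higher
    than layer [j] do not help, because the descent to layer [j] is not
    positive. *)
Lemma cut_le (S : pred (vertex G)) j f :
    settles D M f -> (forall x, S x -> lay x <= j)%N ->
    (forall a, S (dsrc a) -> ~~ S (dtgt a) -> (lay (dtgt a) <= j)%N ->
       f (dtgt a) < f (dsrc a)) ->
  (\sum_(a : dart G | [&& S (dsrc a), ~~ S (dtgt a) & (lay (dtgt a) <= j)%N]) 1)%:Z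
  <= \sum_(x | S x) D x +
     \sum_(e | [&& S (src e) || S (tgt e), (lay (src e) <= j)%N & (lay (tgt e) <= j)%N]) d e.
Proof.
move=> Rf Sj Sf.
have : 0 <= \sum_(x | S x) chips D M f x by apply: sumr_ge0 => x _.
move=> /le_trans /(_ (sum_chips_le _ _ _ Md)).
rewrite (bigID (fun a => lay (dtgt a) <= j)%N) /=.
set up := (X in _ + (_ + X)).
have up_le0 : up <= 0.
  rewrite /up; case: (boolP (S (hub j))) => Sh.
    apply: le_trans (descent_le0 j Rf); rewrite le_eqVlt; apply/orP; left; apply/eqP.
    apply: eq_bigl => a; rewrite -ltnNge; apply/andP/andP.
      move=> [/andP[Sa _] ja]; have := Sj _ Sa; have := dart_up_le HG a.
      by move=> h1 h2; split; apply/eqP; lia.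
    move=> [/eqP aj /eqP aj1]; rewrite aj1 ltnSn (dart_up_hub HG) aj // Sh /=.
    by split=> //; apply/negP => /Sj; rewrite aj1 ltnn.
  rewrite big_pred0 // => a; apply/negbTE/negP; rewrite -ltnNge => /andP[/andP[Sa _] ja].
  have aj : lay (dsrc a) = j by have := Sj _ Sa; have := dart_up_le HG a; lia.
  by case/negP: Sh; rewrite -aj -(dart_up_hub HG) // aj; have := dart_up_le HG a; lia.
set out := (X in _ + (X + _)).
have out_le : out <= \sum_(a | (S (dsrc a) && ~~ S (dtgt a)) && (lay (dtgt a) <= j)%N) (d a.1 - 1).
  by apply: ler_sum => a /andP[/andP[Sa Sa'] aj]; apply: gain_down_lt; apply: Sf.
set dS := \sum_(e | S (src e) && S (tgt e)) d e; set DS := \sum_(x | S x) D x.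
set card := \sum_(a | _) 1%N; set dout := \sum_(e | _) d e.
have : dS + \sum_(a | (S (dsrc a) && ~~ S (dtgt a)) && (lay (dtgt a) <= j)%N) d a.1 <= dout.
  rewrite /dS /dout [in X in X + _]big_mkcond [in X in _ + X]big_mkcond sum_dart.
  rewrite -big_split [leRHS]big_mkcond /=; apply: ler_sum => e _.
  rewrite /dsrc /dtgt /=; have := d_ge0 e.
  by case: (boolP (S (src e))) => [/Sj ->|_]; case: (boolP (S (tgt e))) => [/Sj ->|_];
    rewrite /= ?andbT ?andbF ?addr0 ?add0r //; do ?case: ifP.
rewrite sumrB in out_le; move: out_le.
have -> : \sum_(a | (S (dsrc a) && ~~ S (dtgt a)) && (lay (dtgt a) <= j)%N) 1 = card%:Z.
  rewrite sumr_const /card sum1_card natz; congr Posz.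
  by apply: eq_card => a; rewrite ?inE /in_mem /= andbA.
by lra.
Qed.

Definition chips_upto j : int :=
  \sum_(x | (lay x <= j)%N) D x +
  \sum_(e | (lay (src e) <= j)%N && (lay (tgt e) <= j)%N) d e.

Lemma chips_uptoS j : chips_upto j.+1 = chips_upto j +
  (\sum_(x | lay x == j.+1) D x +
   \sum_(e | ((lay (src e) == j.+1) || (lay (tgt e) == j.+1)) &&
      (lay (src e) <= j.+1)%N && (lay (tgt e) <= j.+1)%N) d e).
Proof.
rewrite addrACA; congr (_ + _).
  rewrite (bigID (fun x => lay x <= j)%N) /=.
  by congr (_ + _); apply: eq_bigl => x; lia.
rewrite (bigID (fun e => (lay (src e) <= j) && (lay (tgt e) <= j))%N) /=.
by congr (_ + _); apply: eq_bigl => x; lia.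
Qed.

Hypothesis reach : forall w, exists2 f, settles D M f & 1 <= chips D M f w.

(** The set of vertices at least as high as the hub below [w] contains this hub
    but not [w]; its boundary is counted by [cut_layer]. *)
Lemma chips_upto_hub_lt j w f : settles D M f -> lay w = j.+1 -> f w < f (hub j) ->
  (below j.+1 + 1)%:Z <= chips_upto j.+1.
Proof.
move=> Rf wj fw; have jm : (j < m)%N by rewrite -wj (lay_le HG).
have hubj : lay (hub j) = j by rewrite (lay_hub HG) // ltnW.
pose S x := (lay x <= j.+1)%N && (f (hub j) <= f x).
have Sj x : S x -> (lay x <= j.+1)%N by case/andP.
have Sf a : S (dsrc a) -> ~~ S (dtgt a) -> (lay (dtgt a) <= j.+1)%N ->
    f (dtgt a) < f (dsrc a).
  move=> /andP[_ h1]; rewrite /S => /nandP[/negPf->//|]; rewrite -ltNge => h2 _.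
  exact: lt_le_trans h2 h1.
pose Z x := (lay x == j.+1) && ~~ S x.
have Zw : Z w by rewrite /Z /S wj eqxx leqnn /= -ltNge.
have ZS x : Z x -> lay x = j.+1 by case/andP=> /eqP.
apply: le_trans (le_trans _ (cut_le Rf Sj Sf)) _.
  rewrite lez_nat; apply: leq_trans (cut_layer HG Zw ZS) _.
  rewrite [leqRHS]big_mkcond [leqLHS]big_mkcond; apply: leq_sum => a _.
  case: ifP => // /andP[Sa /andP[/eqP aj Sa']]; rewrite Sa' aj leqnn andbT.
  suff -> : S (dsrc a) by [].
  case/orP: Sa => [/eqP ->|/andP[/eqP aj']]; first by rewrite /S hubj leqW //=.
  by rewrite /Z aj' eqxx /= negbK.
rewrite /chips_upto lerD //; last first.
  rewrite [leRHS]big_mkcond [leLHS]big_mkcond; apply: ler_sum => e _.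
  by case: ifP => [/and3P[_ -> ->]|_] //; case: ifP => // _; apply: d_ge0.
rewrite [leRHS]big_mkcond [leLHS]big_mkcond; apply: ler_sum => x _.
by rewrite /S; case: (lay x <= j.+1)%N => //=; case: ifP.
Qed.

(** Cut [f] off from below at its value at the hub and restrict it to the block:
    [w] still gets its chip.  If the result is constant on the block, that chip
    was on [w] from the start.  Otherwise the vertices higher than the hub form
    a set whose boundary is paid for by the chips of the block alone. *)
Lemma chips_block j w f : settles D M f -> 1 <= chips D M f w ->
    lay w = j.+1 -> f (hub j) <= f w ->
  1 <= D w \/
  chips_upto j + #|[pred x | lay x == j.+1]|%:Z <= chips_upto j.+1.
Proof.
move=> Rf f_w wj fw; have jm : (j < m)%N by rewrite -wj (lay_le HG).
have hubj : lay (hub j) = j by rewrite (lay_hub HG) // ltnW.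
set c := f (hub j) in fw *.
pose g x := Num.max (block_part j f x) c.
have g_ge x : c <= g x by rewrite le_max lexx orbT.
have bp_c x : (lay x <= j)%N -> block_part j f x = c by rewrite /block_part => ->.
have g_c x : (lay x <= j)%N -> g x = c by move=> /bp_c xj; rewrite /g xj maxxx.
have g_bp x : (j < lay x)%N -> c <= block_part j f x ->
    (if (lay x <= j.+1)%N then chips D M f x else D x) <= chips D M g x.
  move=> xj cx; have gx : block_part j f x = g x by rewrite /g max_l.
  have bpg y : block_part j f y <= g y by rewrite le_max lexx.
  apply: le_trans (chips_le_max _ _ gx bpg).
  by have := chips_block_part x (ltnW jm) (descent_le0 j.+1 Rf); rewrite leqNgt xj.
have Rg : settles D M g.
  move=> x; case: (leP (block_part j f x) c) => [le_c|/ltW ge_c].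
    by apply: (chips_ge_floor (c := c)); rewrite // /g max_r.
  have [xj|xj] := leqP (lay x) j.
    by apply: (chips_ge_floor (c := c)); rewrite // g_c.
  by apply: le_trans (g_bp x xj ge_c); case: ifP => _ //; apply: D_ge0.
have g_w : 1 <= chips D M g w.
  have := g_bp w; rewrite /block_part wj ltnn leqnn => /(_ isT fw).
  exact: le_trans.
pose S x := (lay x == j.+1) && (c < g x).
case: (pickP S) => [z Sz|S0].
  right; rewrite chips_uptoS lerD2l.
  have Sj x : S x -> (lay x <= j.+1)%N by case/andP=> /eqP ->.
  have Sf a : S (dsrc a) -> ~~ S (dtgt a) -> (lay (dtgt a) <= j.+1)%N ->
      g (dtgt a) < g (dsrc a).
    move=> /andP[_ h1] Sa aj; apply: le_lt_trans h1.
    have [/g_c ->//|ja] := leqP (lay (dtgt a)) j.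
    move: Sa; rewrite /S => /nandP[|].
      by case/negP; rewrite eqn_leq aj.
    by rewrite -leNgt.
  have Sj' x : S x -> lay x = j.+1 by case/andP=> /eqP.
  apply: le_trans (le_trans _ (cut_le Rg Sj Sf)) _.
    rewrite lez_nat; apply: leq_trans (leq_trans (cut_layer HG Sz Sj') _).
      by rewrite belowS addnAC leq_addl.
    rewrite sum_drev [leqRHS]big_mkcond [leqLHS]big_mkcond; apply: leq_sum => a _.
    rewrite dsrc_rev dtgt_rev.
    case: ifP => // /andP[Sa Sa']; rewrite Sa'.
    case/orP: Sa => [/eqP ->|/andP[/eqP aj ->]]; last by rewrite aj leqnn.
    by rewrite /S hubj ltn_eqF //= leqW.
  rewrite lerD //; last first.
    rewrite [leRHS]big_mkcond [leLHS]big_mkcond; apply: ler_sum => e _.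
    rewrite -andbA; case: ifP => [/andP[Se ->]|_]; last by case: ifP => // _; apply: d_ge0.
    by case/orP: Se => /andP[-> _]; rewrite ?orbT.
  rewrite [leRHS]big_mkcond [leLHS]big_mkcond; apply: ler_sum => x _.
  by rewrite /S; case: (lay x == j.+1) => //=; case: ifP.
left; apply: le_trans g_w _; rewrite gerDl; apply: sumr_le0 => a /eqP aw.
have gj x : lay x = j.+1 -> g x = c.
  by move=> xj; apply/eqP; rewrite eq_le g_ge leNgt andbT; have := S0 x; rewrite /S xj eqxx /= => ->.
rewrite gain_flat // aw (gj w wj).
have [/g_c->//|aj] := leqP (lay (dtgt a)) j.
have := dart_up_le HG a; rewrite aw wj leq_eqVlt => /orP[/eqP ajj|ajj]; last first.
  by rewrite gj //; apply/eqP; rewrite eqn_leq aj andbT -ltnS.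
have aup : lay (dtgt a) = (lay (dsrc a)).+1 by rewrite aw wj.
have wh : w = hub j.+1 by rewrite -aw (dart_up_hub HG aup) aw wj.
rewrite -(gj w wj) /g /block_part wj ajj !ltnn leqnn wh !ifN //; lia.
Qed.

Lemma chips_upto_ge j : (j <= m)%N -> (below j + 1)%:Z <= chips_upto j.
Proof.
elim: j => [_|j IH jm].
  have h0 : lay (hub 0) = 0%N by rewrite (lay_hub HG).
  have [f Rf f1] := reach (hub 0); have := descent_le0 0 Rf.
  have D1 : 1 <= D (hub 0).
    move: f1; rewrite chips_split h0 eqxx big1 ?addr0 => [|a /andP[/eqP ax]].
      by have := descent_le0 0 Rf; lia.
    rewrite leqn0 => /eqP /(lay0_hub HG) ah.
    by have := dsrc_neq_dtgt a; rewrite ax ah eqxx.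
  move=> _; rewrite /below big_geq // /chips_upto (bigD1 (hub 0)) ?h0 //=.
  rewrite -addrA; apply: le_trans D1 _; rewrite lerDl addr_ge0 // sumr_ge0 // => *.
  exact: d_ge0.
have {IH} IH := IH (ltnW jm).
case: (boolP [forall w, (lay w == j.+1) ==> (1 <= D w)]) => [/forallP occ|].
  rewrite belowS chips_uptoS addnAC PoszD lerD // -[leLHS]addr0 lerD //; last first.
    by apply: sumr_ge0 => *; exact: d_ge0.
  rewrite -natz -sumr_const; apply: ler_sum => x xj.
  by rewrite inE in xj; have := occ x; rewrite xj.
rewrite negb_forall => /existsP[w]; rewrite negb_imply => /andP[/eqP wj /negP Dw].
have [f Rf fw] := reach w.
have [lt_w|ge_w] := ltP (f w) (f (hub j)); first exact: chips_upto_hub_lt Rf wj lt_w.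
have [//|] := chips_block Rf fw wj ge_w; apply: le_trans.
by rewrite belowS addnAC PoszD lerD2r.
Qed.

End Reduced.

(** The moments after [f0] has been applied: each edge is left with at most one
    interior chip, whose distances to the two ends are the fractional parts of
    the two arguments of the floor. *)
Definition rebase (M : dart G -> R) f0 (a : dart G) : R :=
  f0 (dtgt a) - f0 (dsrc a) + M a - (gain M f0 a)%:~R.

Lemma gain_rebase M f f0 a :
  gain (rebase M f0) f a = gain M (fun x => f x + f0 x) a - gain M f0 a.
Proof.
rewrite {1}/gain /rebase addrA -mulrNz floorDrz ?intr_int // intrKfloor.
by congr (Num.floor _ + _); ring.
Qed.

Lemma chips_rebase D M f f0 x :
  chips (chips D M f0) (rebase M f0) f x = chips D M (fun x => f x + f0 x) x.
Proof.
rewrite /chips -addrA -big_split /=; congr (_ + _); apply: eq_bigr => a _.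
by rewrite gain_rebase addrC subrK.
Qed.

(** The layers above [i] send down at most as many chips as they hold. *)
Lemma descent_bounded (D : vertex G -> int) M (d : edge G -> int) i :
    (forall e, M (e, true) + M (e, false) = (d e)%:~R) ->
  exists B, forall f, settles D M f -> descent M i f <= B.
Proof.
move=> Md; pose S x := (i < lay x)%N.
pose K : int := \sum_(x | S x) D x + \sum_(e | S (src e) && S (tgt e)) d e.
pose dout : int := \sum_(a : dart G | S (dsrc a) && ~~ S (dtgt a)) d a.1.
exists (K + dout) => f Rf.
have h : 0 <= \sum_(x | S x) chips D M f x by apply: sumr_ge0 => x _.
have {h} := le_trans h (sum_chips_le _ _ _ Md).
rewrite -/K; set out := \sum_(a | _) gain M f a => h.
suff : out + descent M i f <= dout by lra.
have -> : descent M i f = \sum_(a | S (dsrc a) && ~~ S (dtgt a)) gain M f (drev a).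
  rewrite /descent sum_drev; apply: eq_bigl => a; rewrite dsrc_rev dtgt_rev /S.
  by have := dart_down_le HG a; lia.
rewrite -big_split /=; apply: ler_sum => a _; apply: gain_rev; rewrite -Md.
by case: a => e [] //; rewrite addrC.
Qed.

Lemma exists_max (T : Type) (P : T -> Prop) (v : T -> int) (B : int) :
    (exists x, P x) -> (forall x, P x -> v x <= B) ->
  exists2 x, P x & forall y, P y -> v y <= v x.
Proof.
move=> [x Px] vB; have [n] : exists n, (`|B - v x| <= n)%N by exists `|B - v x|%N.
elim: n x Px => [|n IH] x Px nx; have := vB x Px.
  by move=> ?; exists x => // y /vB; lia.
move=> vx; have [[y [Py yx]]|h] := EM (exists y, P y /\ v x < v y).
  by apply: (IH y Py); have := vB y Py; lia.
by exists x => // y Py; rewrite leNgt; apply/negP => yx; apply: h; exists y.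
Qed.

(** The bound does not depend on the representative of the class of [D], so it is
    enough to treat the one with the largest total descent. *)
Theorem degree_ge (D : vertex G -> int) (M : dart G -> R) (d : edge G -> int) :
    (forall e, M (e, true) + M (e, false) = (d e)%:~R) ->
    (forall v, solvable (fun x => D x - chip v x) M) ->
  (below m + 1)%:Z <= \sum_x D x + \sum_e d e.
Proof.
move=> Md reach.
have {}reach w : exists2 f : vertex G -> R, settles D M f & 1 <= chips D M f w.
  have [f Rf] := reach w; have chE x : chips (fun x => D x - chip w x) M f x =
      chips D M f x - chip w x by rewrite /chips addrAC.
  exists f => [x|]; last by have := Rf w; rewrite chE /chip eqxx subr_ge0.
  by have := Rf x; rewrite chE subr_ge0; apply: le_trans; rewrite /chip ler0n.
have [B Bb] : exists B : 'I_m -> int, forall (i : 'I_m) (f : vertex G -> R), settles D M f -> descent M i f <= B i.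
  have [B Bb] := choice (fun i : 'I_m => descent_bounded D i Md); by exists B.
have [f0 Rf0 max0] : exists2 f0 : vertex G -> R, settles D M f0 & forall f, settles D M f ->
    \sum_(i < m) descent M i f <= \sum_(i < m) descent M i f0.
  apply: (exists_max (B := \sum_i B i)); first by have [f] := reach (hub 0); exists f.
  by move=> f Rf; apply: ler_sum => i _; exact: Bb.
pose D' := chips D M f0; pose M' := rebase M f0.
pose d' e := d e - (gain M f0 (e, true) + gain M f0 (e, false)).
have settlesE f : settles D' M' f <-> settles D M (fun x => f x + f0 x).
  by split=> Rf x; have := Rf x; rewrite chips_rebase.
have Md' e : M' (e, true) + M' (e, false) = (d' e)%:~R.
  rewrite /M' /rebase /d' /dsrc /dtgt /= intrB intrD -Md; ring.
have M01 a : 0 <= M' a < 1.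
  have := floor_itv (f0 (dtgt a) - f0 (dsrc a) + M a).
  rewrite /M' /rebase /gain intrD; lra.
have hmax f : settles D' M' f -> \sum_(i < m) descent M' i f <= 0.
  move/settlesE/max0; rewrite -subr_le0 -sumrB; apply: le_trans.
  by apply: ler_sum => i _; rewrite -sumrB; apply: ler_sum => a _; rewrite gain_rebase.
have reach' w : exists2 f, settles D' M' f & 1 <= chips D' M' f w.
  have [f Rf fw] := reach w; pose h x := f x - f0 x.
  have hE : (fun x => h x + f0 x) = f by apply: funext => x; rewrite subrK.
  by exists h; [apply/settlesE; rewrite hE|rewrite chips_rebase hE].
have := chips_upto_ge Md' M01 Rf0 hmax reach' (leqnn m).
rewrite /chips_upto (eq_bigl xpredT) => [|x]; last by rewrite (lay_le HG).
rewrite [X in _ + X](eq_bigl xpredT) => [|e]; last by rewrite !(lay_le HG).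
by rewrite /D' sum_chips /d' sumrB -addrA [X in _ + X]addrC subrK.
Qed.

End LowerBound.

(** * A divisor that reaches every pair of vertices *)
Section UpperBound.
Variables (R : archiRealFieldType) (G : graph).
Variables (m : nat) (lay : vertex G -> nat) (hub : nat -> vertex G).
Hypothesis HG : layered m lay hub.

Local Notation below := (below lay).

Definition spread (x : vertex G) : int := 1 + chip (hub 0) x.

(** The result of collecting on [v] the chips of its own and all lower layers,
    starting from [spread]. *)
Definition pile (v x : vertex G) : int :=
  if x == v then (below (lay v) + 2)%:Z else (lay v < lay x)%N%:Z.

Lemma spread_pile : spread =1 pile (hub 0).
Proof.
move=> x; rewrite /spread /pile /chip (lay_hub HG) //; case: eqP => [_|x0].
  by rewrite /below big_geq.
by rewrite addr0 lt0n; case: eqP => // /(lay0_hub HG).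
Qed.

(** Fire every vertex but [v] and, if [v] is a hub, but those of the higher
    layers, which hang on [v].  The hub below has exactly the chips for its
    edges to [v], each other vertex of the layer has one chip for its only edge
    to [v], and no other boundary edge exists. *)
Lemma fire_above i v : lay v = i.+1 -> exists h : vertex G -> int, forall x,
  pile v x <= pile (hub i) x + \sum_(a | dsrc a == x) (h (dtgt a) - h x).
Proof.
move=> vi; have im : (i < m)%N by rewrite -vi (lay_le HG).
have hubi : lay (hub i) = i by rewrite (lay_hub HG) // ltnW.
pose Z x := (x == v) || ((v == hub i.+1) && (i.+1 < lay x)%N).
exists (fun x => (~~ Z x)%:Z) => x.
have [Zx|Zx] := boolP (Z x).
  have -> : \sum_(a | dsrc a == x) ((~~ Z (dtgt a))%:Z - (~~ true)%:Z) =
      (\sum_(a : dart G | (dsrc a == x) && ~~ Z (dtgt a)) 1)%N%:Z.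
    rewrite big_mkcondr /= (big_morph _ PoszD (erefl 0%:Z)).
    by apply: eq_bigr => a _; rewrite subr0; case: (Z _).
  have [xv|xv] := eqVneq x v; last first.
    have /andP[_ xi] : (v == hub i.+1) && (i.+1 < lay x)%N.
      by move: Zx; rewrite /Z (negPf xv).
    rewrite /pile (negPf xv) vi xi hubi; case: eqP => [xh|_]; first by rewrite xh hubi in xi; lia.
    by rewrite (ltnW xi) lerDl.
  rewrite xv /pile eqxx vi hubi ltnSn; case: eqP => [vh|_]; first by rewrite vh hubi in vi; lia.
  have v_i x' : x' == v -> lay x' = i.+1 by move/eqP->.
  have := cut_layer (Z := pred1 v) HG (eqxx v) v_i; rewrite sum_drev => h.
  suff : (below i.+1 + 1 <= \sum_(a : dart G | (dsrc a == v) && ~~ Z (dtgt a)) 1)%N.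
    by rewrite -PoszD lez_nat; lia.
  apply: leq_trans h _; rewrite [leqLHS]big_mkcond [leqRHS]big_mkcond.
  apply: leq_sum => a _; rewrite dsrc_rev dtgt_rev; case: ifP => //= /andP[ha ->].
  suff -> : ~~ Z (dtgt a) by [].
  case/orP: ha => [/eqP->|/andP[/eqP ai av]].
    by rewrite /Z hubi; case: eqP => [hv|_]; [rewrite -hv hubi in vi|]; lia.
  by rewrite /Z (negPf av) ai ltnn andbF.
have -> : \sum_(a | dsrc a == x) ((~~ Z (dtgt a))%:Z - (~~ false)%:Z) =
    - (\sum_(a : dart G | (dsrc a == x) && Z (dtgt a)) 1)%N%:Z.
  rewrite big_mkcondr /= (big_morph _ PoszD (erefl 0%:Z)) -sumrN.
  by apply: eq_bigr => a _; case: (Z _).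
have xv : x != v by apply: contraNneq Zx => ->; rewrite /Z eqxx.
have : (\sum_(a : dart G | (dsrc a == x) && Z (dtgt a)) 1 <= mult x v)%N.
  rewrite big_mkcond /mult [leqRHS]big_mkcond; apply: leq_sum => a _.
  case: ifP => // /andP[/eqP ax]; rewrite /Z => /orP[->|/andP[/eqP vh ai]]; first by rewrite ax eqxx.
  have := dart_up_le HG a; rewrite ax => ha.
  have xi : lay x = i.+1.
    by apply/eqP; rewrite eqn_leq; move: Zx; rewrite /Z (negPf xv) vh eqxx /=; lia.
  case/eqP: xv; rewrite -ax (dart_up_hub HG) ax xi //; lia.
rewrite /pile (negPf xv) vi hubi.
have [xi|xi|xi] := ltngtP (lay x) i.+1.
- have [->|xh] := eqVneq x (hub i); first by rewrite (mult_up HG) hubi ?vi // eqxx; lia.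
  have -> : mult x v = 0%N; last by lia.
  have [xi'|xi'] := eqVneq (lay x) i.
    by rewrite (mult_up HG) ?xi' ?vi // (negPf xh).
  by rewrite (mult_far HG) // vi; lia.
- have xh : x != hub i by apply: contraTneq xi => ->; rewrite hubi; lia.
  have -> : mult x v = 0%N; last by rewrite (negPf xh); lia.
  have vh : v != hub i.+1.
    by apply: contraNneq Zx => vh; rewrite /Z xi vh eqxx orbT.
  rewrite multC; have [xi'|xi'] := eqVneq (lay x) i.+2.
    by rewrite (mult_up HG) ?xi' ?vi // (negPf vh).
  by rewrite (mult_far HG) // vi; lia.
have xh : x != hub i by apply: contra_eq_neq xi => ->; rewrite hubi; lia.
rewrite (mult_layer HG) ?vi // (negPf xh); lia.
Qed.

Lemma reach_pile v : exists h : vertex G -> int, forall x,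
  pile v x <= spread x + \sum_(a | dsrc a == x) (h (dtgt a) - h x).
Proof.
move: {2}(lay v) (erefl (lay v)) => i; elim: i v => [|i IH] v vi.
  exists (fun=> 0) => x; rewrite (lay0_hub HG vi) spread_pile lerDl.
  by apply: sumr_ge0 => a _; rewrite subr0.
have [h1 h1P] := fire_above vi.
have hubi : lay (hub i) = i by rewrite (lay_hub HG) // ltnW // -vi (lay_le HG).
have [h2 h2P] := IH _ hubi; exists (fun x => h1 x + h2 x) => x.
apply: le_trans (h1P x) _; apply: le_trans (lerD (h2P x) (lexx _)) _.
rewrite -addrA lerD2l -big_split /=; apply: ler_sum => a _; lra.
Qed.

Lemma pile_ge v w : (lay v < lay w)%N || (v == w) ->
  forall x, chip v x + chip w x <= pile v x.
Proof.
rewrite /pile /chip => vw x; case: (eqVneq x v) vw => [->|xv].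
  by case: (v == w); case: (_ < _)%N => //= _; lia.
case: (eqVneq x w) xv => [->|xw] xv; rewrite add0r //.
by rewrite eq_sym (negPf xv) orbF => ->.
Qed.

(** If [v] is in a lower layer than [w], collecting on [v] leaves a chip on [w];
    if both are in the same layer, collecting on the hub below leaves a chip on
    each of them; and a pile always has at least two chips. *)
Theorem spread_solvable v w :
  solvable (fun x => spread x - chip v x - chip w x) (fun=> 0 : R).
Proof.
suff [u uP] : exists u, forall x, chip v x + chip w x <= pile u x.
  have [h hP] := reach_pile u; exists (fun x => (h x)%:~R) => x.
  rewrite /chips (eq_bigr (fun a => h (dtgt a) - h x)) => [|a /eqP ax].
    by have := uP x; have := hP x; lra.
  by rewrite /gain addr0 ax -intrB intrKfloor.
wlog le_vw : v w / (lay v <= lay w)%N.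
  move=> hw; case: (leqP (lay v) (lay w)) => [/hw //|/ltnW/hw [u uP]].
  by exists u => x; rewrite addrC.
have [->|vw] := eqVneq v w; first by exists w; apply: pile_ge; rewrite eqxx orbT.
move: le_vw; rewrite leq_eqVlt => /orP[/eqP vw_lay|lt_vw]; last first.
  by exists v; apply: pile_ge; rewrite lt_vw.
case vi: (lay v) => [|i].
  by case/eqP: vw; rewrite (lay0_hub HG vi) (lay0_hub HG (etrans (esym vw_lay) vi)).
have hubi : lay (hub i) = i by rewrite (lay_hub HG) // ltnW // -vi (lay_le HG).
exists (hub i) => x; rewrite /pile /chip hubi.
have [->|xv] := eqVneq x v.
  rewrite (negPf vw) vi ltnSn; case: eqP => // vh; rewrite vh hubi in vi; lia.
have [->|xw] := eqVneq x w; last by case: eqP.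
rewrite -vw_lay vi ltnSn; case: eqP => // _; lia.
Qed.

Lemma degree_spread : \sum_x spread x = (below m + 2)%:Z.
Proof.
rewrite big_split /= sumr_const natz.
have -> : \sum_x chip (hub 0) x = 1.
  by rewrite (bigD1 (hub 0)) //= big1 ?addr0 /chip ?eqxx // => x /negPf ->.
suff -> : #|vertex G| = (below m + 1)%N by lia.
rewrite -sum1_card (partition_big (fun x => inord (lay x) : 'I_m.+1) xpredT) //=.
rewrite big_ord_recl /below big_add1 /= big_mkord addnC; congr (_ + _)%N.
  apply: eq_bigr => i _; rewrite -sum1_card; apply: eq_bigl => x.
  by rewrite inE -val_eqE /= inordK // ltnS (lay_le HG).
rewrite (big_pred1 (hub 0)) // => x; rewrite -val_eqE /= inordK ?ltnS ?(lay_le HG) //.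
by apply/eqP/eqP => [/(lay0_hub HG)|->] //; rewrite (lay_hub HG).
Qed.

End UpperBound.

(** * Additive functionals on divisors *)
Section FreegSum.
Variables (P : choiceType) (A : zmodType).
Implicit Types (phi : P -> A) (D : {freeg P}).

Definition freeg_sum phi D : A := \sum_(p <- dom D) phi p *~ coeff p D.

Lemma eq_freeg_sum phi psi D : phi =1 psi -> freeg_sum phi D = freeg_sum psi D.
Proof. by move=> eqf; apply: eq_bigr => p _; rewrite eqf. Qed.

Lemma freeg_sumE_sub phi D (s : seq P) :
  uniq s -> {subset dom D <= s} -> freeg_sum phi D = \sum_(p <- s) phi p *~ coeff p D.
Proof.
move=> us Ds; rewrite [RHS](bigID (mem (dom D))) /= [X in _ + X]big1 => [|p pD].
  rewrite addr0 -big_filter; apply: perm_big; apply: uniq_perm.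
  - exact: uniq_dom.
  - exact: filter_uniq.
  by move=> p; rewrite mem_filter; apply/idP/andP => [pD|[]//]; split=> //; exact: Ds.
by rewrite coeff_outdom ?mulr0z.
Qed.

Lemma freeg_sumB phi D E : freeg_sum phi (D - E) = freeg_sum phi D - freeg_sum phi E.
Proof.
pose s := undup (dom D ++ dom E); have us : uniq s by exact: undup_uniq.
rewrite !(@freeg_sumE_sub _ _ s) //.
- by rewrite -sumrB; apply: eq_bigr => p _; rewrite coeffB mulrzBr.
- by move=> p pE; rewrite mem_undup mem_cat pE orbT.
- by move=> p pD; rewrite mem_undup mem_cat pD.
by move=> p; rewrite mem_undup; exact: domB.
Qed.

Lemma freeg_sum0 phi : freeg_sum phi 0 = 0.
Proof. by rewrite /freeg_sum dom0 big_nil. Qed.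

Lemma freeg_sumD phi : {morph freeg_sum phi : D E / D + E}.
Proof.
by move=> D E; rewrite -[E in LHS]opprK -[- E]sub0r !freeg_sumB freeg_sum0 sub0r opprK.
Qed.

Lemma freeg_sumU phi p : freeg_sum phi << p >> = phi p.
Proof. by rewrite /freeg_sum domU1 big_seq1 coeffU eqxx mulr1z. Qed.

Lemma freeg_sum_add phi psi D :
  freeg_sum phi D + freeg_sum psi D = freeg_sum (fun p => phi p + psi p) D.
Proof. by rewrite -big_split; apply: eq_bigr => p _; rewrite mulrzDl. Qed.

Lemma freeg_sum_sum (I : finType) (phi : I -> P -> A) D :
  \sum_i freeg_sum (phi i) D = freeg_sum (fun p => \sum_i phi i p) D.
Proof.
rewrite exchange_big; apply: eq_bigr => p _.
by rewrite -(big_morph (fun x => x *~ coeff p D) (fun x y => mulrzDl _ x y) (mul0rz _ _)).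
Qed.

End FreegSum.

Lemma freeg_sum_coeff (P : choiceType) q (D : {freeg P}) :
  freeg_sum (fun p => (p == q)%:R : int) D = coeff q D.
Proof.
have [qD|qD] := boolP (q \in dom D).
  rewrite /freeg_sum (bigD1_seq q) ?uniq_dom //= eqxx big1 ?addr0 => [|p /negPf->].
    by rewrite intz.
  by rewrite mul0rz.
rewrite coeff_outdom // /freeg_sum big_seq big1 // => p pD.
by case: eqP pD qD => [-> ->|]; rewrite ?mul0rz.
Qed.

Lemma freeg_sum_deg (P : choiceType) (D : {freeg P}) :
  freeg_sum (fun=> 1 : int) D = deg D.
Proof.
rewrite -{2}(freeg_sumE D) raddf_sum; apply: eq_bigr => p _.
by rewrite /= degU intz.
Qed.

(** * Rank and gonality from minimal degree *)
Section Rank.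
Variables (P : choiceType) (lineq : {freeg P} -> {freeg P} -> Prop).
Implicit Types (D E : {freeg P}).

Lemma effectiveB1 E (r : nat) : effective E -> deg E = r.+1%:Z ->
  exists p, effective (E - << p >>) /\ deg (E - << p >>) = r%:Z.
Proof.
move=> Ee dE; have [p Ep] : exists p, 0 < coeff p E.
  apply: contrapT => h; suff : E = 0 by move=> E0; rewrite E0 deg0 in dE.
  apply/eqP/freeg_eqP => p; rewrite coeff0; apply/eqP; rewrite eq_le Ee andbT.
  by rewrite leNgt; apply/negP => Ep; apply: h; exists p.
exists p; split; last by rewrite degB degU dE; lia.
move=> q; rewrite coeffB coeffU mul1r; case: eqP => [<-|_]; first by rewrite subr_ge0 -gtz0_ge1.
by rewrite subr0.
Qed.

Lemma rank_ge0 D : equiv_effective lineq D -> rank_ge lineq D 0.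
Proof.
move=> De E Ee E0; suff -> : E = 0 by rewrite subr0.
by apply: fgpos_eq0P => //; apply/fgposP.
Qed.

Lemma rank_geS D r : (forall p, rank_ge lineq (D - << p >>) r) -> rank_ge lineq D r.+1.
Proof.
move=> Dr E Ee /(effectiveB1 Ee)[p [Ee' dE']].
by have := Dr p _ Ee' dE'; rewrite opprB addrA subrK.
Qed.

Lemma rank_geB1 D r p : rank_ge lineq D r.+1 -> rank_ge lineq (D - << p >>) r.
Proof.
move=> Dr E Ee dE; rewrite -addrA -opprD; apply: Dr => [q|].
  by rewrite coeffD addr_ge0 ?Ee // coeffU; case: eqP.
by rewrite degD degU dE; lia.
Qed.

Lemma rank_geB1n D r k p : rank_ge lineq D (k + r) ->
  rank_ge lineq (D - << p >> *+ k) r.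
Proof.
elim: k D => [|k IH] D; first by rewrite mulr0n subr0.
by move=> /(rank_geB1 p)/IH; rewrite mulrS opprD addrA.
Qed.

(** Removing a chip lowers the rank by at most one.  So a lower bound on the
    degrees of divisors of rank at least 1 is a bound, larger by one, for rank at
    least 2, and it also prevents the ranks of [D] and of [D] minus a chip from
    being larger than 2 and 1. *)
Lemma gonality_pair D (p : P) (n : int) :
    (forall E, rank_ge lineq E 1 -> n <= deg E) ->
    (forall E, rank_ge lineq E 1 -> equiv_effective lineq E) ->
    rank_ge lineq D 2 -> equiv_effective lineq D -> deg D = n + 1 ->
  is_gonality lineq 1 n /\ is_gonality lineq 2 (n + 1).
Proof.
move=> n_le r1e D2 De dD.
have rank_le E r s : deg E = n + r%:Z -> rank_ge lineq E s -> (s <= r.+1)%N.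
  move=> dE Es; rewrite leqNgt; apply/negP => rs.
  have := n_le _ (rank_geB1n p (_ : rank_ge lineq E (s.-1 + 1))).
  rewrite addn1 prednK ?(leq_ltn_trans _ rs) // => /(_ Es).
  rewrite degB degMn degU dE -mulr_natr; lia.
have is_rankP E (r : nat) : is_rank lineq E r%:Z -> rank_ge lineq E r.
  by case=> [[_]|[_ [s [[->]]]]].
split; split.
- exists (D - << p >>); last by rewrite degB degU dD addrK.
  right; split; first by apply: r1e; exact: rank_geB1.
  exists 1%N; split=> // [|s]; first exact: rank_geB1.
  by apply: (rank_le _ 0%N); rewrite degB degU dD addrK addr0.
- by move=> E /is_rankP; exact: n_le.
- exists D => //; right; split=> //; exists 2%N; split=> // s; exact: (rank_le _ 1%N).
move=> E /is_rankP /(rank_geB1 p)/n_le; rewrite degB degU; lra.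
Qed.

Lemma gonality_unique r k k' : is_gonality lineq r k -> is_gonality lineq r k' -> k = k'.
Proof.
by move=> [[D Dr <-] h] [[D' Dr' <-] h']; apply/eqP; rewrite eq_le h ?h'.
Qed.

End Rank.

(** * Gonalities from the vertex criterion *)
Section Model.
Variables (R : archiRealFieldType) (G : graph).
Variables (P : choiceType) (loc : P -> vertex G + edge G * R).
Implicit Types (D E : {freeg P}).

(** The points of [P] are placed on the metric graph by [loc], a point inside an
    edge being given by its distance from the source. *)
Definition at_vertex (x : vertex G) (p : P) : int := (loc p == inl x)%:R.

Definition at_edge (a : dart G) (p : P) : R :=
  if loc p is inr (e, t) then moment e t a else 0.

Definition vertex_part D (x : vertex G) : int := freeg_sum (at_vertex x) D.
Definition edge_moment D (a : dart G) : R := freeg_sum (at_edge a) D.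

Definition edge_degree D (e : edge G) : int :=
  freeg_sum (fun p => if loc p is inr (e', t) then (e' == e)%:R else 0) D.

Lemma edge_moment_degree D e :
  edge_moment D (e, true) + edge_moment D (e, false) = (edge_degree D e)%:~R.
Proof.
rewrite freeg_sum_add /edge_degree /freeg_sum rmorph_sum; apply: eq_bigr => p _.
rewrite /at_edge /moment rmorphMz; congr (_ *~ _).
case: (loc p) => [x|[e' t]] /=; first by rewrite addr0.
by rewrite eq_sym; case: eqP => _; rewrite ?addr0 ?subrK.
Qed.

Lemma vertex_edge_degree D : \sum_x vertex_part D x + \sum_e edge_degree D e = deg D.
Proof.
rewrite /vertex_part /edge_degree !freeg_sum_sum freeg_sum_add -freeg_sum_deg.
apply: eq_freeg_sum => p; rewrite /at_vertex.
case: (loc p) => [x|[e t]].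
  rewrite (bigD1 x) //= eqxx !big1 ?addr0 // => y /negPf yx.
  by rewrite (inj_eq (@inl_inj _ _)) eq_sym yx.
rewrite big1 // (bigD1 e) //= eqxx big1 ?addr0 ?add0r // => y /negPf.
by rewrite eq_sym => ->.
Qed.

Variables (lineq : {freeg P} -> {freeg P} -> Prop) (vert : vertex G -> P).
Hypothesis loc_vert : forall x, loc (vert x) = inl x.
Hypothesis loc_itv : forall p e t, loc p = inr (e, t) -> 0 <= t <= 1.
Hypothesis equiv_effectiveP : forall D,
  equiv_effective lineq D <-> solvable (vertex_part D) (edge_moment D).

Lemma vertex_partB1 D p : vertex_part (D - << p >>) =
  fun x => vertex_part D x - at_vertex x p.
Proof. by apply: funext => x; rewrite /vertex_part freeg_sumB freeg_sumU. Qed.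

Lemma edge_momentB1 D p : edge_moment (D - << p >>) =
  fun a => edge_moment D a - at_edge a p.
Proof. by apply: funext => a; rewrite /edge_moment freeg_sumB freeg_sumU. Qed.

Lemma solvableB_vert D v :
  equiv_effective lineq (D - << vert v >>) <->
  solvable (fun x => vertex_part D x - chip v x) (edge_moment D).
Proof.
rewrite equiv_effectiveP vertex_partB1 edge_momentB1.
have -> : (fun x => vertex_part D x - at_vertex x (vert v)) =
    (fun x => vertex_part D x - chip v x).
  apply: funext => x; rewrite /at_vertex loc_vert /chip.
  by rewrite (inj_eq (@inl_inj _ _)) eq_sym.
have -> // : (fun a => edge_moment D a - at_edge a (vert v)) = edge_moment D.
by apply: funext => a; rewrite /at_edge loc_vert subr0.
Qed.

(** [solvable_interior] in terms of divisors. *)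
Lemma rank_determining D :
    (forall v, equiv_effective lineq (D - << vert v >>)) ->
  forall p, equiv_effective lineq (D - << p >>).
Proof.
move=> Dv p; have [[v|[e t]] lp] : {z | loc p = z} by exists (loc p).
  have : equiv_effective lineq (D - << vert v >>) by [].
  rewrite !equiv_effectiveP !vertex_partB1 !edge_momentB1 /at_vertex /at_edge.
  by rewrite lp loc_vert.
rewrite equiv_effectiveP vertex_partB1 edge_momentB1 /at_vertex /at_edge lp /=.
have -> : (fun x => vertex_part D x - 0) = vertex_part D.
  by apply: funext => x; rewrite subr0.
apply: (solvable_interior (edge_moment_degree D e) (loc_itv lp)); exact/solvableB_vert.
Qed.

Section QuasiBanana.
Variables (m : nat) (lay : vertex G -> nat) (hub : nat -> vertex G).
Hypothesis HG : layered m lay hub.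

(** The passage from pairs of vertices to pairs of points replaces the two
    vertices by arbitrary points one after the other. *)
Theorem model_gonality :
  is_gonality lineq 1 (below lay m + 1)%:Z /\
  is_gonality lineq 2 ((below lay m + 1)%:Z + 1).
Proof.
pose D : {freeg P} := << vert (hub 0) >> + \sum_x << vert x >>.
have sumD (A : zmodType) (phi : P -> A) :
    freeg_sum phi D = phi (vert (hub 0)) + \sum_x phi (vert x).
  rewrite freeg_sumD freeg_sumU; congr (_ + _).
  rewrite (big_morph (freeg_sum phi) (freeg_sumD phi) (freeg_sum0 phi)).
  by apply: eq_bigr => x _; rewrite freeg_sumU.
have vD : vertex_part D = spread hub.
  apply: funext => x; rewrite /vertex_part sumD (bigD1 x) //= big1 => [|y /negPf yx].
    by rewrite /at_vertex !loc_vert !(inj_eq (@inl_inj _ _)) eqxx addr0 addrC eq_sym.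
  by rewrite /at_vertex loc_vert (inj_eq (@inl_inj _ _)) yx.
have eD : edge_moment D = fun=> 0.
  apply: funext => a; rewrite /edge_moment sumD big1 ?addr0 => [|x _];
  by rewrite /at_edge loc_vert.
have D_solvable v w : equiv_effective lineq (D - << vert v >> - << vert w >>).
  apply/solvableB_vert; rewrite vertex_partB1 edge_momentB1 vD eD.
  have := spread_solvable R HG v w; rewrite /at_vertex /at_edge loc_vert subrr.
  congr (solvable _ _); apply: funext => x; congr (_ - _ - _).
  by rewrite /chip (inj_eq (@inl_inj _ _)) eq_sym.
have D2 : rank_ge lineq D 2.
  apply: rank_geS => p; apply: rank_geS => q; apply: rank_ge0.
  move: q; apply: rank_determining => v.
  rewrite addrAC; move: p; apply: rank_determining => w.
  exact: D_solvable.
have effB E v : equiv_effective lineq (E - << vert v >>) -> equiv_effective lineq E.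
  rewrite solvableB_vert equiv_effectiveP => -[f Rf]; exists f => x.
  have := Rf x; rewrite /chips addrAC subr_ge0; apply: le_trans.
  by rewrite /chip ler0n.
have r1B E v : rank_ge lineq E 1 -> equiv_effective lineq (E - << vert v >>).
  move=> E1; apply: E1; last by rewrite degU.
  by move=> q; rewrite coeffU; case: eqP.
apply: (gonality_pair (D := D) (vert (hub 0))) => //.
- move=> E E1; rewrite -vertex_edge_degree.
  by apply: (degree_ge HG (edge_moment_degree E)) => v; apply/solvableB_vert/r1B.
- by move=> E /r1B/effB; apply; exact: (hub 0).
- exact: effB (effB _ _ (D_solvable (hub 0) (hub 0))).
rewrite -vertex_edge_degree vD (degree_spread HG).
rewrite /edge_degree big1 ?addr0 => [|e _]; first by rewrite -PoszD; congr Posz; lia.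
rewrite sumD big1 ?addr0 => [|x _]; by rewrite loc_vert.
Qed.

End QuasiBanana.
End Model.

(** * Firing scripts on a graph *)
Section Firing.
Variable G : graph.
Implicit Types (D : {freeg vertex G}) (h : vertex G -> int).

(** The divisor of the indicator function of [v]: what one firing of [v] adds. *)
Definition firing (v : vertex G) : {freeg vertex G} :=
  \sum_(a | dsrc a == v) (<< dtgt a >> - << v >>).

Lemma fireE v D : fire v D = D + firing v.
Proof. by rewrite /fire -addrA /firing sum_dsrcE. Qed.

Lemma coeff_firings h x :
  coeff x (\sum_v firing v *~ h v) = \sum_(a | dsrc a == x) (h (dtgt a) - h x).
Proof.
have coeffMz (z : int) (E : {freeg vertex G}) : coeff x (E *~ z) = coeff x E * z.
  by rewrite raddfMz mulrzz.
rewrite raddf_sum /= sumrB [X in _ = X - _]sum_drev.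
transitivity (\sum_a ((dtgt a == x)%:R * h (dsrc a) - (dsrc a == x)%:R * h x)).
  rewrite -sum_dsrc; apply: eq_bigr => v _; rewrite coeffMz raddf_sum /= mulr_suml.
  apply: eq_bigr => a /eqP <-; rewrite coeffB !coeffU !mul1r mulrBl.
  by case: (dsrc a =P x) => [->|]; rewrite // !mul0r.
rewrite sumrB; congr (_ - _); rewrite [RHS]big_mkcond; apply: eq_bigr => a _.
  by rewrite dsrc_rev dtgt_rev; case: eqP; rewrite ?mul1r ?mul0r.
by case: eqP; rewrite ?mul1r ?mul0r.
Qed.

Lemma chip_equivP D D' : chip_equiv D D' <-> exists h, D' = D + \sum_v firing v *~ h v.
Proof.
split.
  elim=> {D D'} [D D' [v [->|->]]|D|D1 D2 D3 _ [h1 ->] _ [h2 ->]].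
  - exists (chip v); rewrite fireE (bigD1 v) //= /chip eqxx mulr1z big1 ?addr0 // => w /negPf->.
    by rewrite mulr0z.
  - exists (fun x => - chip v x); rewrite fireE (bigD1 v) //= /chip eqxx mulrNz mulr1z.
    by rewrite big1 ?addr0 ?addrK // => w /negPf->; rewrite oppr0 mulr0z.
  - by exists (fun=> 0); rewrite big1 ?addr0 // => v _; rewrite mulr0z.
  exists (fun x => h1 x + h2 x); rewrite -addrA -big_split /=; congr (_ + _).
  by apply: eq_bigr => v _; rewrite mulrzDr.
move=> [h ->]; pose Q (X : {freeg vertex G}) := forall D, chip_equiv D (D + X).
have QD X Y : Q X -> Q Y -> Q (X + Y).
  by move=> QX QY E; rewrite addrA; apply: rt_trans (QX E) (QY _).
have Q0 : Q 0 by move=> E; rewrite addr0; exact: rt_refl.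
have QMn X n : Q X -> Q (X *+ n).
  by move=> QX; elim: n => [|n IH]; rewrite ?mulr0n // mulrS; exact: QD.
have Qf v : Q (firing v) by move=> E; apply: rt_step; exists v; left; rewrite fireE.
have QNf v : Q (- firing v).
  by move=> E; apply: rt_step; exists v; right; rewrite fireE subrK.
suff : Q (\sum_v firing v *~ h v) by apply.
elim/big_ind: _ => // v _; case: (h v) => n; first by rewrite -pmulrn; exact: QMn.
by rewrite NegzE mulrNz -mulNrz -pmulrn; exact: QMn.
Qed.

Lemma chip_effectiveP D : equiv_effective (@chip_equiv G) D <->
  exists h, forall x, 0 <= coeff x D + \sum_(a | dsrc a == x) (h (dtgt a) - h x).
Proof.
split=> [[D' D'e /chip_equivP[h D'E]]|[h hP]].
  by exists h => x; have := D'e x; rewrite D'E coeffD coeff_firings.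
exists (D + \sum_v firing v *~ h v); last by apply/chip_equivP; exists h.
by move=> x; rewrite coeffD coeff_firings.
Qed.

End Firing.

Section GraphModel.
Variables (R : archiRealFieldType) (G : graph).

Definition graph_loc (x : vertex G) : vertex G + edge G * R := inl x.

(** There are no interior chips here, and rounding down a real solution gives an
    integral one. *)
Lemma graph_effectiveP (D : {freeg vertex G}) :
  equiv_effective (@chip_equiv G) D <->
  solvable (vertex_part graph_loc D) (edge_moment graph_loc D).
Proof.
have vE : vertex_part graph_loc D = fun x => coeff x D.
  apply: funext => x; rewrite -freeg_sum_coeff.
  by apply: eq_freeg_sum => p; rewrite /at_vertex (inj_eq (@inl_inj _ _)).
have eE : edge_moment graph_loc D = fun=> 0.
  by apply: funext => a; rewrite /edge_moment /freeg_sum big1 // => p _; rewrite mul0rz.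
rewrite chip_effectiveP vE eE; split=> [[h hP]|[f fP]].
  exists (fun x => (h x)%:~R) => x; apply: le_trans (hP x) _.
  rewrite lerD2l; apply: ler_sum => a /eqP <-.
  by rewrite /gain addr0 -intrB intrKfloor.
exists (fun x => Num.floor (f x)) => x; apply: le_trans (fP x) _.
rewrite lerD2l; apply: ler_sum => a /eqP <-; rewrite /gain addr0 lerBrDr.
rewrite floor_ge_int intrD.
by have := floor_le (f (dtgt a) - f (dsrc a)); have := floor_le (f (dsrc a)); lra.
Qed.

End GraphModel.

(** * Potentials on a path *)
Section PathPotential.
Variables (l : nat) (c : nat -> int).

(** The vertices inside a path with [l.+1] edges are numbered from 0 to [l - 1],
    the one numbered [i] being at distance [i.+1] from the left end and carrying
    [c i] chips.  The two moments are taken about the right and the left end. *)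
Definition left_moment : int := \sum_(i < l) c i * (l - i)%N%:Z.
Definition right_moment : int := \sum_(i < l) c i * i.+1%:Z.

(** With potential [H] along the path, the chips inside it stay nonnegative. *)
Definition bends (H : nat -> int) := forall i, (i < l)%N ->
  0 <= c i + ((H i.+2 - H i.+1) + (H i - H i.+1)).

(** Each chip lowers the slope by at most 1 from its position onwards, which
    costs at most its distance to the right end. *)
Lemma bends_left H : bends H ->
  (H 1%N - H 0%N) * l.+1%:Z <= H l.+1 - H 0%N + left_moment.
Proof.
move=> Hb; set s := H 1%N - H 0%N.
suff step n : (n <= l)%N -> s <= H n.+1 - H n + \sum_(i < n) c i /\
    s * n.+1%:Z <= H n.+1 - H 0%N + \sum_(i < n) c i * (n - i)%N%:Z.
  by have [] := step l (leqnn l).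
elim: n => [|n IH] nl; first by rewrite !big_ord0 !addr0 mulr1.
have [IH1 IH2] := IH (ltnW nl); have := Hb n nl.
have -> : \sum_(i < n.+1) c i * (n.+1 - i)%N%:Z =
    \sum_(i < n) c i * (n - i)%N%:Z + \sum_(i < n.+1) c i.
  rewrite !big_ord_recr /= subSnn mulr1 addrA -big_split /=; congr (_ + _).
  apply: eq_bigr => i _; have in_ := ltn_ord i.
  have -> : (n.+1 - i)%N%:Z = (n - i)%N%:Z + 1 by lia.
  by rewrite mulrDr mulr1.
rewrite big_ord_recr /= (_ : n.+2%:Z = n.+1%:Z + 1) ?mulrDr ?mulr1; last by lia.
move: (\sum_(i < n) c i) (\sum_(i < n) _) IH1 IH2 => S T.
by move: (s * _) => sn; split; lra.
Qed.

(** Start at [alpha] with the integral slope for which, once all chips are used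
    up, the right end stays below [beta] by less than the length of the path.
    One upward bend, at a distance from the right end equal to what is missing,
    corrects this. *)
Lemma bends_exists (alpha beta : int) : exists H,
  [/\ H 0%N = alpha, H l.+1 = beta, bends H,
      forall z, z * l.+1%:Z <= beta - alpha + left_moment -> z <= H 1%N - H 0%N &
      forall z, z * l.+1%:Z <= alpha - beta + right_moment -> z <= H l - H l.+1].
Proof.
pose mu := beta - alpha + left_moment.
pose q := (mu %/ l.+1%:Z)%Z; pose r := `|(mu %% l.+1%:Z)%Z|%N.
have rE : r%:Z = (mu %% l.+1%:Z)%Z by rewrite /r gez0_abs ?modz_ge0.
have muE : mu = q * l.+1%:Z + r%:Z by rewrite rE; exact: divz_eq.
have r_lt : (r < l.+1)%N by have := ltz_pmod mu (isT : 0 < l.+1%:Z); rewrite -rE.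
pose H (k : nat) : int := alpha + q * k%:Z - \sum_(i < l) c i * (k - i.+1)%N%:Z
  + (k - (l.+1 - r))%N%:Z.
have H0 : H 0%N = alpha.
  by rewrite /H mulr0 big1 ?sub0n ?subr0 ?addr0 // => i _; rewrite sub0n mulr0.
have H1 : H 1%N = alpha + q.
  rewrite /H mulr1 big1 => [|i _]; last by rewrite subSS sub0n mulr0.
  rewrite subr0 (_ : (1 - _)%N = 0%N) ?addr0 //; lia.
have HL : H l.+1 = beta.
  rewrite /H subKn 1?ltnW //; under eq_bigr do rewrite subSS.
  by rewrite -/left_moment; move: muE; rewrite /mu; lra.
have Hl : H l - H l.+1 = \sum_(i < l) c i - q - (0 < r)%N%:Z.
  rewrite /H.
  have -> : \sum_(i < l) c i * (l.+1 - i.+1)%N%:Z =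
      \sum_(i < l) c i * (l - i.+1)%N%:Z + \sum_(i < l) c i.
    rewrite -big_split /=; apply: eq_bigr => i _; rewrite subSS subnS.
    by rewrite -[X in _ = _ + X]mulr1 -mulrDr -PoszD addn1 prednK // subn_gt0.
  have -> : (l.+1 - (l.+1 - r))%N%:Z = (l - (l.+1 - r))%N%:Z + (0 < r)%N%:Z by lia.
  rewrite -[in q * l.+1%:Z](addn1 l) PoszD; ring.
exists H; split=> //.
- move=> j jl; pose S k : int := \sum_(i < l) c i * (k - i.+1)%N%:Z.
  have HE k : H k = alpha + q * k%:Z - S k + (k - (l.+1 - r))%N%:Z by [].
  have SE : S j.+2 + S j = S j.+1 + S j.+1 + c j.
    have -> : c j = \sum_(i < l) c i * (i == j :> nat)%:Z.
      rewrite (bigD1 (Ordinal jl)) //= eqxx mulr1 big1 ?addr0 // => i.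
      by rewrite -val_eqE => /negPf /= ->; rewrite mulr0.
    rewrite -!big_split /=; apply: eq_bigr => i _; rewrite -!mulrDr; congr (_ * _).
    by case: eqP => /= ?; lia.
  have pos : 0 <= (j.+2 - (l.+1 - r))%N%:Z + (j - (l.+1 - r))%N%:Z
              - (j.+1 - (l.+1 - r))%N%:Z - (j.+1 - (l.+1 - r))%N%:Z by lia.
  have lin : q * j.+2%:Z + q * j%:Z = q * j.+1%:Z + q * j.+1%:Z.
    by rewrite -!mulrDr; congr (_ * _); lia.
  rewrite (HE j.+2) (HE j.+1) (HE j); clear HE; clearbody S; lra.
- move=> z; rewrite -/mu H1 H0 [alpha + q]addrC addrK => zmu.
  rewrite -ltzD1 -(ltr_pM2r (isT : 0 < l.+1%:Z)) mulrDl mul1r.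
  by apply: le_lt_trans zmu _; rewrite muE ltrD2l ltz_nat.
move=> z zmu; rewrite Hl.
have lr : left_moment + right_moment = (\sum_(i < l) c i) * l.+1%:Z.
  rewrite mulr_suml -big_split /=; apply: eq_bigr => i _.
  by rewrite -mulrDr -PoszD addnS subnK // ltnW.
set S := \sum_(i < l) c i in lr *.
have {}zmu : z * l.+1%:Z <= (S - q) * l.+1%:Z - r%:Z.
  by apply: le_trans zmu _; rewrite mulrBl -lr; move: muE; rewrite /mu; lra.
case: (posnP r) zmu => [->|r0]; first by rewrite !subr0 ler_pM2r.
move=> zmu; rewrite lerBrDr; change (z + 1 <= S - q); rewrite lezD1 -(ltr_pM2r (isT : 0 < l.+1%:Z)).
by apply: le_lt_trans zmu _; rewrite gtrBl ltz_nat.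
Qed.

End PathPotential.

Lemma bends_right l c H : bends l c H ->
  (H l - H l.+1) * l.+1%:Z <= H 0%N - H l.+1 + right_moment l c.
Proof.
move=> Hb; have Hb' : bends l (fun i => c (l.-1 - i)%N) (fun k => H (l.+1 - k)%N).
  move=> i il; have := Hb (l.-1 - i)%N; rewrite [(_ - _ < _)%N](_ : _ = true); last by lia.
  have -> : (l.+1 - i.+2)%N = (l.-1 - i)%N by lia.
  have -> : (l.+1 - i.+1)%N = (l.-1 - i).+1 by lia.
  have -> : (l.+1 - i)%N = (l.-1 - i).+2 by lia.
  by move=> /(_ isT); rewrite [X in _ -> is_true (0 <= _ + X)]addrC.
have := bends_left Hb'; rewrite subn1 subn0 subnn /=.
suff -> : left_moment l (fun i => c (l.-1 - i)%N) = right_moment l c by [].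
rewrite /left_moment (reindex_inj rev_ord_inj) /=; apply: eq_bigr => i _.
have il := ltn_ord i.
by congr (c _ * _%:Z); lia.
Qed.

(** * The criterion for subdivisions *)
Section SubdivisionModel.
Variables (R : archiRealFieldType) (l : nat) (G : graph).

Local Notation sub := (subdivision l G).

Definition sub_loc (p : vertex sub) : vertex G + edge G * R :=
  match p with
  | inl x => inl x
  | inr (e, i) => inr (e, i.+1%:R / l.+1%:R)
  end.

Lemma sub_src_inl (e : edge G) (k : 'I_l.+1) x :
  (sub_src (e, k) == inl x :> sub_vertex l G) = (src e == x) && (k == ord0).
Proof.
case: k => [[|k] hk]; rewrite /sub_src /= -val_eqE /= ?andbT ?andbF //.
by rewrite insubT.
Qed.

Lemma sub_tgt_inl (e : edge G) (k : 'I_l.+1) x :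
  (sub_tgt (e, k) == inl x :> sub_vertex l G) = (tgt e == x) && (k == ord_max).
Proof.
rewrite /sub_tgt /= -val_eqE /=; case: insubP => [i kl _|kl].
  by rewrite (ltn_eqF kl) andbF.
by rewrite eqn_leq -ltnS ltn_ord leqNgt kl !andbT.
Qed.

Lemma sub_src_inr (e e' : edge G) (k : 'I_l.+1) (i : 'I_l) :
  (sub_src (e, k) == inr (e', i) :> sub_vertex l G) = (e == e') && (k == fintype.lift ord0 i).
Proof.
case: k => [[|k] hk]; rewrite /sub_src /= -val_eqE /= ?andbF //.
by rewrite insubT //= (inj_eq (@inr_inj _ _)) xpair_eqE -val_eqE.
Qed.

Lemma sub_tgt_inr (e e' : edge G) (k : 'I_l.+1) (i : 'I_l) :
  (sub_tgt (e, k) == inr (e', i) :> sub_vertex l G) = (e == e') && (k == widen_ord (leqnSn l) i).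
Proof.
rewrite /sub_tgt /= -val_eqE /=; case: insubP => [j _ jk|kl].
  by rewrite (inj_eq (@inr_inj _ _)) xpair_eqE -val_eqE jk.
by rewrite (_ : (k == i :> nat) = false) ?andbF //; apply/negP => /eqP ki; rewrite ki ltn_ord in kl.
Qed.

(** The pieces that start at a given vertex of the subdivision all have the same
    position along their edges, and so have those that end there. *)
Lemma sum_sub_edge (A : nmodType) (Q : pred (edge G)) (k0 : 'I_l.+1)
    (P : pred (sub_edge l G)) (F : sub_edge l G -> A) :
    (forall e k, P (e, k) = Q e && (k == k0)) ->
  \sum_(y | P y) F y = \sum_(e | Q e) F (e, k0).
Proof.
move=> PQ; rewrite big_mkcond /=.
transitivity (\sum_e \sum_(k : 'I_l.+1) if P (e, k) then F (e, k) else 0).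
  by rewrite pair_bigA; apply: eq_bigr => -[].
rewrite [RHS]big_mkcond; apply: eq_bigr => e _.
rewrite (bigD1 k0) //= PQ eqxx andbT big1 ?addr0 // => k /negPf kk0.
by rewrite PQ kk0 andbF.
Qed.

Lemma sum_sub_vertex (h : vertex sub -> int) x :
  \sum_(a : dart sub | dsrc a == inl x) (h (dtgt a) - h (inl x)) =
  \sum_(a : dart G | dsrc a == x)
    (h (sub_point l a.1 (if a.2 then 1 else l)) - h (inl x)).
Proof.
rewrite !sum_dsrcE; congr (_ + _).
  by rewrite (sum_sub_edge (Q := fun e => src e == x) (k0 := ord0)) // => e k; exact: sub_src_inl.
by rewrite (sum_sub_edge (Q := fun e => tgt e == x) (k0 := ord_max)) // => e k; exact: sub_tgt_inl.
Qed.

Lemma sum_sub_interior (h : vertex sub -> int) e (i : 'I_l) :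
  \sum_(a : dart sub | dsrc a == inr (e, i)) (h (dtgt a) - h (inr (e, i))) =
  (h (sub_point l e i.+2) - h (sub_point l e i.+1)) +
  (h (sub_point l e i) - h (sub_point l e i.+1)).
Proof.
rewrite sum_dsrcE sub_pointS; congr (_ + _).
  rewrite (sum_sub_edge (Q := pred1 e) (k0 := fintype.lift ord0 i)) ?big_pred1_eq //.
  by move=> e' k; exact: sub_src_inr.
rewrite (sum_sub_edge (Q := pred1 e) (k0 := widen_ord (leqnSn l) i)) ?big_pred1_eq //.
by move=> e' k; exact: sub_tgt_inr.
Qed.

Lemma sub_loc_itv p e t : sub_loc p = inr (e, t) -> 0 <= t <= 1.
Proof.
case: p => [x|[e' i]] //= [_ <-]; rewrite divr_ge0 ?ler0n //=.
by rewrite ler_pdivrMr ?ltr0n // mul1r ler_nat ltnS ltnW.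
Qed.

Definition edge_chips (D : {freeg vertex sub}) (e : edge G) (k : nat) : int :=
  if insub k is Some i then coeff (inr (e, i : 'I_l) : vertex sub) D else 0.

Lemma sub_edge_moment (D : {freeg vertex sub}) e b :
  edge_moment sub_loc D (e, b) * l.+1%:R =
  (if b then left_moment l (edge_chips D e) else right_moment l (edge_chips D e))%:~R.
Proof.
have L0 : l.+1%:R != 0 :> R by rewrite pnatr_eq0.
rewrite /edge_moment (freeg_sumE_sub _ (s := index_enum (vertex sub))); last first.
- by move=> p _; rewrite mem_index_enum.
- exact: index_enum_uniq.
rewrite big_sumType /= big1 ?add0r => [|x _]; last by rewrite mul0rz.
transitivity (\sum_(i < l) (edge_chips D e i * (if b then l - i else i.+1)%N%:Z)%:~R : R).
  transitivity ((\sum_e' \sum_(i < l) at_edge sub_loc (e, b) (inr (e', i)) *~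
      coeff (inr (e', i) : vertex sub) D) * l.+1%:R).
    by rewrite pair_bigA; congr (_ * _); apply: eq_bigr => -[].
  rewrite (bigD1 e) //= [X in _ + X]big1 ?addr0 => [|e' /negPf ee']; last first.
    by apply: big1 => i _; rewrite /at_edge /moment /= eq_sym ee' mul0rz.
  rewrite mulr_suml; apply: eq_bigr => i _; rewrite /at_edge /moment /= eqxx.
  rewrite /edge_chips valK intrM -mulrzr -mulrA mulrC -mulrA; congr (_ * _).
  have il := ltn_ord i; case: b; last by rewrite mulrC divfK.
by rewrite mulrC mulrBl mul1r divfK // -natrB ?subSS // ltnW.
by rewrite -rmorph_sum; case: b.
Qed.

Lemma sub_vertex_part (D : {freeg vertex sub}) x :
  vertex_part sub_loc D x = coeff (inl x : vertex sub) D.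
Proof.
by rewrite -freeg_sum_coeff; apply: eq_freeg_sum => -[y|[e i]].
Qed.

(** On each subdivided edge [bends_left] and [bends_right] bound the two end
    slopes by the floors, and [bends_exists] attains them. *)
Lemma sub_effectiveP (D : {freeg vertex sub}) :
  equiv_effective (@chip_equiv sub) D <->
  solvable (vertex_part sub_loc D) (edge_moment sub_loc D).
Proof.
rewrite chip_effectiveP; have L0 : 0 < l.+1%:R :> R by rewrite ltr0n.
have chipsE e i (il : (i < l)%N) : edge_chips D e i =
    coeff (inr (e, Ordinal il) : vertex sub) D by rewrite /edge_chips insubT.
split=> [[h hP]|[f fP]].
  exists (fun x => (h (inl x))%:~R / l.+1%:R) => x.
  apply: le_trans (hP (inl x)) _; rewrite /chips sum_sub_vertex sub_vertex_part lerD2l.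
  apply: ler_sum => -[e b] /eqP ax; rewrite floor_ge_int.
  have Hb : bends l (edge_chips D e) (fun k => h (sub_point l e k)).
    move=> i il; have := hP (inr (e, Ordinal il)).
    by rewrite sum_sub_interior /= chipsE.
  rewrite -(ler_pM2r L0) mulrDl mulrBl !divfK ?gt_eqF // sub_edge_moment.
  rewrite -[l.+1%:R]/(l.+1%:Z%:~R) -intrM -intrB -intrD ler_int -ax.
  case: b {ax}; rewrite /dsrc /dtgt /=.
    by have := bends_left Hb; rewrite sub_point_max.
  by have := bends_right Hb; rewrite sub_point_max.
(* in units of the new edges the moments are integers, so that rounding [f] down
   keeps every inequality that a floor expresses *)
pose F x := Num.floor (f x * l.+1%:R).
have [H HP] := choice (fun e => bends_exists l (edge_chips D e) (F (src e)) (F (tgt e))).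
pose h (p : vertex sub) : int :=
  match p with inl x => F x | inr (e, i) => H e i.+1 end.
have hH e k : (k <= l.+1)%N -> h (sub_point l e k) = H e k.
  have [H0 HL _ _ _] := HP e.
  case: k => [_|k kl]; first by rewrite H0.
  move: kl; rewrite ltnS leq_eqVlt => /orP[/eqP->|kl].
    by rewrite sub_point_max HL.
  by rewrite -[k]/(val (Ordinal kl)) sub_pointS.
exists h => -[x|[e i]]; last first.
  have [_ _ Hb _ _] := HP e; have := Hb i (ltn_ord i).
  have il := ltn_ord i; rewrite /edge_chips valK => Hi.
  by rewrite sum_sub_interior !hH //; lia.
apply: le_trans (fP x) _; rewrite /chips sum_sub_vertex sub_vertex_part lerD2l.
apply: ler_sum => -[e b] /eqP ax.
have floorP (z M : int) y y' : z%:~R <= f y' - f y + edge_moment sub_loc D (e, b) ->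
    edge_moment sub_loc D (e, b) * l.+1%:R = M%:~R ->
    z * l.+1%:Z <= F y' - F y + M.
  rewrite -(ler_pM2r L0) mulrDl mulrBl => h1 h2; move: h1; rewrite h2 => h1.
  suff : z * l.+1%:Z - M + F y <= F y' by lra.
  rewrite floor_ge_int intrD intrB intrM; have := floor_le (f y * l.+1%:R).
  by rewrite /F -[l.+1%:Z%:~R]/(l.+1%:R); lra.
have [H0 HL _ Hl Hr] := HP e; rewrite hH; last by case: (b).
have := floor_le (f (dtgt (e, b)) - f (dsrc (e, b)) + edge_moment sub_loc D (e, b)).
move=> /floorP /(_ (sub_edge_moment D e b)); rewrite -ax /dsrc /dtgt.
by case: b {ax floorP} => /= [/Hl|/Hr]; rewrite ?H0 ?HL.
Qed.

End SubdivisionModel.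

(** * One-sided slopes and convexity *)
Section Germs.
Variable R : realType.
Implicit Types (g : R -> R) (c : int) (t u : R).

(** [c] is the slope of [g] on leaving 0 to the right; [right_germ] and
    [left_germ] are the slopes on leaving [t] in the two directions, so that a
    bend at [t] shows as a nonzero sum of the two. *)
Definition germ g c := exists2 eps : R, 0 < eps &
  forall h, 0 <= h <= eps -> g h = g 0 + c%:~R * h.

Definition right_germ g t c := germ (fun h => g (t + h)) c.
Definition left_germ g t c := germ (fun h => g (t - h)) c.

Lemma germ_uniq g c c' : germ g c -> germ g c' -> c = c'.
Proof.
move=> [e e0 ge] [e' e'0 ge']; pose m := Num.min e e'.
have m0 : 0 < m by rewrite lt_min e0.
have := ge m; have := ge' m; rewrite !ge_min !lexx !orbT ltW // => /(_ isT) -> /(_ isT).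
by move/addrI/mulIf => /(_ (lt0r_neq0 m0))/eqP; rewrite eqr_int => /eqP.
Qed.

Lemma germ_incoming g c : germ g c -> incoming_slope g = - c.
Proof.
move=> gc; have [e e0 ge] := gc; apply: xget_unique.
  exists e => // h he; rewrite (ge h he) mulrNz mulNr; ring.
move=> c' [e' e'0 ge']; apply: oppr_inj; rewrite opprK; apply: (germ_uniq (g := g)) => //.
by exists e' => // h /ge'; rewrite mulrNz mulNr => <-; ring.
Qed.

Lemma germD g g' c c' : germ g c -> germ g' c' -> germ (fun h => g h + g' h) (c + c').
Proof.
move=> [e e0 ge] [e' e'0 ge']; exists (Num.min e e'); first by rewrite lt_min e0.
move=> h /andP[h0]; rewrite le_min => /andP[he he'].
by rewrite ge ?h0 // ge' ?h0 // intrD; ring.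
Qed.

Lemma germZ g c k : germ g c -> germ (fun h => k%:~R * g h) (k * c).
Proof. by move=> [e e0 ge]; exists e => // h /ge ->; rewrite intrM; ring. Qed.

Lemma germ_affine a c : germ (fun h => a + c%:~R * h) c.
Proof. by exists 1 => // h _; rewrite mulr0 addr0. Qed.

Lemma germ_eq g g' c : germ g c ->
  (exists2 eps, 0 < eps & forall h, 0 <= h <= eps -> g h = g' h) -> germ g' c.
Proof.
move=> [e e0 ge] [e' e'0 gg']; exists (Num.min e e'); first by rewrite lt_min e0.
move=> h /andP[h0]; rewrite le_min => /andP[he he'].
by rewrite -(gg' h) ?h0 // -(gg' 0) ?lexx ?ltW // (ge h) ?h0.
Qed.

(** The convex function that bends upwards once, at [p]; a sum of hinges weighted
    by the coefficients of a divisor has that divisor as second derivative. *)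
Definition hinge (p t : R) : R := Num.max 0 (t - p).

Lemma hinge0 p t : t <= p -> hinge p t = 0.
Proof. by move=> tp; rewrite /hinge max_l // subr_le0. Qed.

Lemma hingeE p t : p <= t -> hinge p t = t - p.
Proof. by move=> tp; rewrite /hinge max_r // subr_ge0. Qed.

Lemma hinge_right p t : right_germ (hinge p) t (p <= t).
Proof.
rewrite /right_germ; have [pt|tp] := leP p t.
  exists 1 => // h /andP[h0 _]; rewrite (_ : _%:~R = 1) // !hingeE; lra.
exists (p - t); first by rewrite subr_gt0.
by move=> h /andP[h0 hp]; rewrite !hinge0 ?mul0r ?addr0 //; lra.
Qed.

Lemma hinge_left p t : left_germ (hinge p) t (- (p < t)%R%:Z).
Proof.
rewrite /left_germ; have [pt|tp] := ltP p t.
  exists (t - p); first by rewrite subr_gt0.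
  by move=> h /andP[h0 hp]; rewrite (_ : _%:~R = -1) // !hingeE; lra.
by exists 1 => // h /andP[h0 hp]; rewrite (_ : _%:~R = 0) // !hinge0; lra.
Qed.

Definition hinges (s : seq (int * R)) t : R := \sum_(x <- s) x.1%:~R * hinge x.2 t.

Lemma hinges_right s t :
  right_germ (hinges s) t (\sum_(x <- s) x.1 * (x.2 <= t)%R%:Z).
Proof.
elim: s => [|x s IH].
  by exists 1 => // h _; rewrite /hinges !big_nil mul0r addr0.
rewrite big_cons; apply: germ_eq (germD (germZ x.1 (hinge_right x.2 t)) IH) _.
by exists 1 => // h _; rewrite /hinges big_cons.
Qed.

Lemma hinges_left s t :
  left_germ (hinges s) t (- \sum_(x <- s) x.1 * (x.2 < t)%R%:Z).
Proof.
elim: s => [|x s IH].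
  by exists 1 => // h _; rewrite /hinges !big_nil mul0r addr0.
rewrite big_cons opprD -mulrN.
apply: germ_eq (germD (germZ x.1 (hinge_left x.2 t)) IH) _.
by exists 1 => // h _; rewrite /hinges big_cons.
Qed.

Lemma hinges_affine s t0 t1 : (forall x, x \in s -> ~~ (t0 < x.2 < t1)) ->
  forall t, t0 <= t <= t1 ->
  hinges s t = hinges s t0 + (\sum_(x <- s) x.1 * (x.2 <= t0)%R%:Z)%:~R * (t - t0).
Proof.
move=> s_out t /andP[t0t tt1]; rewrite rmorph_sum /= mulr_suml -big_split /=.
apply: eq_big_seq => x /s_out; rewrite intrM -mulrA -mulrDr.
case: (leP x.2 t0) => [xt0 _|t0x].
  by rewrite (_ : true%:Z%:~R = 1 :> R) // !hingeE; lra.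
rewrite /= -leNgt => t1x.
by rewrite (_ : false%:Z%:~R = 0 :> R) // !hinge0; lra.
Qed.

Lemma hinges_le0 s t : (forall x, x \in s -> t <= x.2) -> hinges s t = 0.
Proof. by move=> h; apply: big1_seq => x /andP[_ /h xt]; rewrite hinge0 // mulr0. Qed.

Lemma hinges_ge s t : (forall x, x \in s -> x.2 <= t) ->
  hinges s t = \sum_(x <- s) x.1%:~R * (t - x.2).
Proof. by move=> h; apply: eq_big_seq => x /h xt; rewrite hingeE. Qed.

(** A function without downward bends stays above its first tangent.  The slope
    may change at finitely many points not known in advance, hence a supremum:
    let [T] be the supremum of the points up to which the slope is at least
    [s].  On the left of [T] the slope is at least [s], and so it is on the right
    of [T], by convexity; then [T] cannot be less than 1. *)
Lemma convex_chord g s : right_germ g 0 s ->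
    (forall t, 0 < t <= 1 -> exists c, left_germ g t c) ->
    (forall t, 0 < t < 1 -> exists c, right_germ g t c) ->
    (forall t c c', 0 < t < 1 -> left_germ g t c -> right_germ g t c' -> 0 <= c + c') ->
  g 0 + s%:~R <= g 1.
Proof.
move=> g0 gl gr gconv.
pose A := [set t : R | 0 <= t <= 1 /\ forall u, 0 <= u < t ->
  g 0 + s%:~R * u <= g u /\ exists2 c, right_germ g u c & s <= c]%classic.
have A_step t e c : 0 <= t -> t < 1 -> 0 < e -> s <= c ->
    (forall h, 0 <= h <= e -> g (t + h) = g (t + 0) + c%:~R * h) ->
    g 0 + s%:~R * t <= g t -> A t -> A (Num.min (t + e) 1).
  move=> t0 t1 e0 sc ge gt [_ At]; split.
    by rewrite ge_min lexx orbT andbT le_min ler01 andbT; lra.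
  move=> u /andP[u0]; rewrite lt_min => /andP[ute u1].
  have [ut|tu] := ltP u t; first by apply: At; rewrite u0.
  have sc' : s%:~R <= c%:~R :> R by rewrite ler_int.
  have guE h : 0 <= h <= t + e - u -> g (u + h) = g t + c%:~R * (u + h - t).
    move=> /andP[h0 hu]; have -> : u + h = t + (u + h - t) by ring.
    by rewrite ge ?addr0; [congr (_ + _ * _); ring|lra].
  split.
    have := guE 0; rewrite !addr0 lexx subr_ge0 (ltW ute) => /(_ isT) ->.
    have : s%:~R * (u - t) <= c%:~R * (u - t) by rewrite ler_wpM2r // subr_ge0.
    by lra.
  exists c => //; exists (t + e - u); first by rewrite subr_gt0.
  by move=> h hh; rewrite guE // guE ?lexx ?subr_ge0 ?ltW //; ring.
have A0 : A 0 by split=> [|u]; [rewrite lexx ler01|move=> /andP[h1 h2]; lra].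
have supA : has_sup A by split; [exists 0|exists 1 => t [/andP[]]].
pose T := sup A.
have T1 : T <= 1 by apply: ge_sup => [|t [/andP[]]] //; exists 0.
have AT_ub t : A t -> t <= T by apply: sup_upper_bound.
have [e e0 ge] := g0.
have T0 : 0 < T.
  have Ae : A (Num.min (0 + e) 1).
    by apply: (A_step 0 e s) => //; rewrite mulr0 addr0.
  by apply: lt_le_trans (AT_ub _ Ae); rewrite lt_min ltr01 andbT add0r.
have AT : A T.
  split; first by rewrite (ltW T0).
  move=> u /andP[u0 uT]; have Tu : 0 < T - u by rewrite subr_gt0.
  have [t [_ At]] := sup_adherent Tu supA.
  by rewrite -/T opprB addrC subrK => ut; apply: At; rewrite u0.
have T01 : 0 < T <= 1 by rewrite T0.
have [cl gcl] := gl T T01; have [e' e'0 ge'] := gcl.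
(* [T - k] lies inside the segment on the left of [T] on which [g] is affine *)
pose k := Num.min (e' / 2) (T / 2).
have k0 : 0 < k by rewrite lt_min !divr_gt0.
have ke : k <= e' / 2 by rewrite ge_min lexx.
have kT : k <= T / 2 by rewrite ge_min lexx orbT.
have [gk [c gc sc]] : g 0 + s%:~R * (T - k) <= g (T - k) /\
    exists2 c, right_germ g (T - k) c & s <= c.
  by apply: AT.2; apply/andP; split; lra.
have gE h : 0 <= h <= e' -> g (T - h) = g T + cl%:~R * h by move/ge'; rewrite subr0.
have cE : c = - cl.
  apply: germ_uniq gc _; exists k => // h /andP[h0 hk].
  have -> : T - k + h = T - (k - h) by ring.
  by rewrite addr0 !gE ?mulrNz; [ring|lra|lra].
have s_cl : s%:~R <= - cl%:~R :> R by rewrite -mulrNz -cE ler_int.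
have gT : g 0 + s%:~R * T <= g T.
  have gkE : g (T - k) = g T + cl%:~R * k by apply: gE; lra.
  have : s%:~R * k <= - cl%:~R * k by rewrite ler_pM2r.
  by rewrite gkE in gk; lra.
have [T_lt1|T_ge1] := ltP T 1; last first.
  by move: gT; have -> : T = 1; [apply/eqP; rewrite eq_le T1|rewrite mulr1].
have T01' : 0 < T < 1 by rewrite T0.
have [cr gcr] := gr T T01'; have [e'' e''0 ge''] := gcr.
have scr : s <= cr.
  by apply: le_trans sc _; rewrite cE -subr_ge0 opprK addrC; exact: gconv gcl gcr.
have := AT_ub _ (A_step T e'' cr (ltW T0) T_lt1 e''0 scr ge'' gT AT).
by rewrite ge_min gerDl; case/orP => h; [move: e''0|move: T_lt1]; rewrite ltNge h.
Qed.

End Germs.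

(** * Piecewise linear functions *)
Section PiecewiseLinear.
Variable R : realType.
Implicit Types (g : R -> R) (a b t : R) (s : seq R).

Lemma piece_right b s t : path <=%R b s -> b <= t < last b s ->
  exists2 i, (i < size s)%N & nth 0 (b :: s) i <= t < nth 0 (b :: s) i.+1.
Proof.
elim: s b => [|x s IH] b /=; first by move=> _ /andP[h1 h2]; lra.
move=> /andP[bx xs] /andP[bt tl]; have [tx|xt] := ltP t x.
  by exists 0%N => //=; rewrite bt.
by have [i i_s it] := IH x xs (introT andP (conj xt tl)); exists i.+1.
Qed.

Lemma piece_left b s t : path <=%R b s -> b < t <= last b s ->
  exists2 i, (i < size s)%N & nth 0 (b :: s) i < t <= nth 0 (b :: s) i.+1.
Proof.
elim: s b => [|x s IH] b /=; first by move=> _ /andP[h1 h2]; lra.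
move=> /andP[bx xs] /andP[bt tl]; have [tx|xt] := leP t x.
  by exists 0%N => //=; rewrite bt.
by have [i i_s it] := IH x xs (introT andP (conj xt tl)); exists i.+1.
Qed.

Lemma PL_on_right a g t : PL_on a g -> 0 <= t < a -> exists c, right_germ g t c.
Proof.
move=> [s [ps <- sP]] /(piece_right ps)[i i_s /andP[t0 t1]].
have [c cP] := sP i i_s; exists c.
exists (nth 0 (0 :: s) i.+1 - t); first by rewrite subr_gt0.
move=> h /andP[h0 hl]; rewrite addr0 cP; last by apply/andP; split; lra.
by rewrite [in RHS]cP; [ring|apply/andP; split; lra].
Qed.

Lemma PL_on_left a g t : PL_on a g -> 0 < t <= a -> exists c, left_germ g t c.
Proof.
move=> [s [ps <- sP]] /(piece_left ps)[i i_s /andP[t0 t1]].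
have [c cP] := sP i i_s; exists (- c).
exists (t - nth 0 (0 :: s) i); first by rewrite subr_gt0.
move=> h /andP[h0 hl]; rewrite subr0 cP; last by apply/andP; split; lra.
by rewrite [in RHS]cP ?mulrNz; [ring|apply/andP; split; lra].
Qed.

(** A function is piecewise linear when it is affine between any two points not
    separated by a breakpoint: sort the breakpoints. *)
Lemma PL_on_build g (B : seq R) :
    (forall t0 t1, 0 <= t0 -> t0 <= t1 -> t1 <= 1 ->
       (forall b, b \in B -> ~~ (t0 < b < t1)) ->
       exists c : int, forall t, t0 <= t <= t1 -> g t = g t0 + c%:~R * (t - t0)) ->
  PL_on 1 g.
Proof.
move=> gP; pose u := sort <=%R [seq b <- B | 0 < b < 1].
have uP b : (b \in u) = (b \in B) && (0 < b < 1).
  by rewrite mem_sort mem_filter andbC.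
have u_sorted : sorted <=%R (0 :: rcons u 1).
  rewrite -rcons_cons /= rcons_path path_sortedE; last exact: le_trans.
  rewrite sort_sorted ?andbT; last exact: le_total.
  apply/andP; split; first by apply/allP => b; rewrite uP => /andP[_ /andP[/ltW]].
  have := mem_last 0 u; rewrite inE => /orP[/eqP ->|]; first exact: ler01.
  by rewrite uP => /andP[_ /andP[_ /ltW]].
exists (rcons u 1); split=> // [|i i_u /=]; first by rewrite last_rcons.
set s := 0 :: rcons u 1 in u_sorted *; have ss : size s = (size u).+2.
  by rewrite /= size_rcons.
have mono j k : (j <= k < size s)%N -> nth 0 s j <= nth 0 s k.
  move=> /andP[jk ks]; apply: (sorted_leq_nth le_trans le_refl _ u_sorted) => //.
  by rewrite inE (leq_ltn_trans jk).
have i1 : (i.+1 < size s)%N by rewrite ss ltnS -(size_rcons u 1).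
have s_last : nth 0 s (size u).+1 = 1 by rewrite /= nth_rcons ltnn eqxx.
have le0s : 0 <= nth 0 s i by apply: (mono 0%N i); exact: ltnW i1.
have les1 : nth 0 s i.+1 <= 1.
  by rewrite -s_last; apply: mono; rewrite ss leqnn andbT -ltnS -ss.
apply: gP.
- exact: le0s.
- by apply: (mono i i.+1); rewrite leqnSn.
- exact: les1.
move=> b bB; apply/negP => /andP[b0 b1].
have b01 : 0 < b < 1.
  apply/andP; split.
    exact: le_lt_trans b0.
  exact: lt_le_trans b1 _.
have bs : b \in s by rewrite inE mem_rcons inE uP bB b01 !orbT.
have [ji|ij] := leqP (index b s) i.
  by have := mono (index b s) i; rewrite ji (ltnW i1) nth_index // => /(_ isT); lra.
by have := mono i.+1 (index b s); rewrite ij index_mem bs nth_index // => /(_ isT); lra.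
Qed.

End PiecewiseLinear.

(** * The criterion for the metric graph *)
Section MetricModel.
Variables (R : realType) (G : graph).
Local Notation Gamma := (unit_metric R G).
Local Notation point := (point Gamma).
Implicit Types (D : {freeg point}) (f : point -> R) (a : dart G) (t : R).

Definition point_loc (p : point) : vertex G + edge G * R :=
  match p with inl x => inl x | inr z => inr (val z) end.

Lemma point_loc_inj : injective point_loc.
Proof. by move=> [x|z] [x'|z'] //= [] => [->|/val_inj->]. Qed.

Lemma point_loc_itv p e t : point_loc p = inr (e, t) -> 0 < t < 1.
Proof. by case: p => // -[[e' t'] ht] [_ <-]. Qed.

Definition dart_point a t : point := segment (Gamma := Gamma) a.1 (if a.2 then t else 1 - t).

Lemma segment_loc (e : edge G) t : 0 < t < 1 ->
  point_loc (segment (Gamma := Gamma) e t) = inr (e, t).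
Proof. by move=> t01; rewrite /segment insubT. Qed.

Lemma segment0 (e : edge G) : segment (Gamma := Gamma) e 0 = inl (src e).
Proof. by rewrite /segment insubN ?lexx //= ltxx. Qed.

Lemma segment1 (e : edge G) : segment (Gamma := Gamma) e 1 = inl (tgt e).
Proof. by rewrite /segment insubN ?ler10 //= ltxx andbF. Qed.

Lemma dart_point0 a : dart_point a 0 = inl (dsrc a).
Proof.
by case: a => e []; rewrite /dart_point /dsrc /= ?subr0 ?segment0 ?segment1.
Qed.

Lemma dart_point1 a : dart_point a 1 = inl (dtgt a).
Proof.
by case: a => e []; rewrite /dart_point /dtgt /= ?subrr ?segment0 ?segment1.
Qed.

Lemma dart_point_loc a t : 0 < t < 1 ->
  point_loc (dart_point a t) = inr (a.1, if a.2 then t else 1 - t).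
Proof. by move=> t01; apply: segment_loc; case: a.2 => //; apply/andP; split; lra. Qed.

Lemma div_vertex f x : div f (inl x) =
  \sum_(a : dart G | dsrc a == x) incoming_slope (fun h => f (dart_point a h)).
Proof. by rewrite sum_dsrcE. Qed.

Lemma div_interior f a t : 0 < t < 1 -> div f (dart_point a t) =
  incoming_slope (fun h => f (dart_point a (t + h))) +
  incoming_slope (fun h => f (dart_point a (t - h))).
Proof.
have divE e u : 0 < u < 1 -> div f (segment (Gamma := Gamma) e u) =
    incoming_slope (fun h => f (segment (Gamma := Gamma) e (u + h))) +
    incoming_slope (fun h => f (segment (Gamma := Gamma) e (u - h))).
  by move=> u01; rewrite {1}/segment insubT.
case: a => e [] t01; rewrite /dart_point /=; first exact: divE.
rewrite divE; last by apply/andP; split; lra.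
rewrite addrC; congr (_ + _); congr incoming_slope; apply: funext => h;
  by congr (f (segment _ _)); ring.
Qed.

Lemma dart_right f a t : PL f -> 0 <= t < 1 ->
  exists c, right_germ (fun u => f (dart_point a u)) t c.
Proof.
case: a => e b /(_ e) PLf /andP[t0 t1]; case: b.
  by apply: (PL_on_right PLf); rewrite t0.
have [|c cP] := PL_on_left PLf (_ : 0 < 1 - t <= 1); first by apply/andP; split; lra.
exists c; apply: germ_eq cP _; exists 1 => // h _.
by congr (f (segment _ _)); rewrite /=; ring.
Qed.

Lemma dart_left f a t : PL f -> 0 < t <= 1 ->
  exists c, left_germ (fun u => f (dart_point a u)) t c.
Proof.
case: a => e b /(_ e) PLf /andP[t0 t1]; case: b.
  by apply: (PL_on_left PLf); rewrite t0.
have [|c cP] := PL_on_right PLf (_ : 0 <= 1 - t < 1); first by apply/andP; split; lra.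
exists c; apply: germ_eq cP _; exists 1 => // h _.
by congr (f (segment _ _)); rewrite /=; ring.
Qed.

Definition on_edge (e : edge G) (p : point) : bool :=
  if point_loc p is inr (e', t) then e' == e else false.

Definition position a (p : point) : R :=
  if point_loc p is inr (e, t) then if a.2 then t else 1 - t else 0.

Definition dart_chips D a : seq (int * R) :=
  [seq (coeff p D, position a p) | p <- dom D & on_edge a.1 p].

Lemma dart_chips_itv D a x : x \in dart_chips D a -> 0 < x.2 < 1.
Proof.
move=> /mapP[p]; rewrite mem_filter => /andP[pe _] -> /=.
move: pe; rewrite /on_edge /position.
have [[y|[e t]] lp] : {z | point_loc p = z} by exists (point_loc p).
  by rewrite lp.
rewrite lp => _; have := point_loc_itv lp.
by case: a.2 => // /andP[h1 h2]; apply/andP; split; lra.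
Qed.

Lemma dart_chips_moment D a :
  \sum_(x <- dart_chips D a) x.1%:~R * (1 - x.2) = edge_moment point_loc D a.
Proof.
rewrite big_map big_filter big_mkcond; apply: eq_bigr => p _ /=.
rewrite /on_edge /position /at_edge; case: (point_loc p) => [x|[e t]]; first by rewrite mul0rz.
rewrite /moment eq_sym; case: eqP => _; last by rewrite mul0rz.
by rewrite mulrzl; case: a.2; rewrite ?subKr.
Qed.

Lemma dart_chips_at D a t : 0 < t < 1 ->
  \sum_(x <- dart_chips D a) x.1 * (x.2 == t)%:Z = coeff (dart_point a t) D.
Proof.
move=> t01; rewrite -freeg_sum_coeff big_map big_filter big_mkcond.
apply: eq_bigr => p _ /=; rewrite mulrzz [RHS]mulrC.
rewrite -(inj_eq point_loc_inj) dart_point_loc // /on_edge /position.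
case: (point_loc p) => [x|[e u]]; first by rewrite mulr0.
rewrite (inj_eq (@inr_inj _ _)) xpair_eqE; case: eqP => _ /=; last by rewrite mulr0.
rewrite natz; case: a.2 => //; congr (_ * _); congr (nat_of_bool _)%:Z.
by apply/eqP/eqP => h; lra.
Qed.

Lemma dart_chips_degree D a :
  \sum_(x <- dart_chips D a) x.1 = edge_degree point_loc D a.1.
Proof.
rewrite big_map big_filter big_mkcond; apply: eq_bigr => p _ /=.
rewrite /on_edge; case: (point_loc p) => [x|[e u]]; first by rewrite mul0rz.
by case: eqP => _; rewrite ?mul0rz ?intz.
Qed.

(** Adding to [f] a hinge at each chip of [D] inside the edge removes all downward
    bends, without changing the initial slope; the hinges add up to the moment
    at the end of the dart. *)
Lemma metric_chord f D a : PL f ->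
    (forall p, div f p <= coeff p D) ->
  exists2 c, germ (fun h => f (dart_point a h)) c &
    c%:~R <= f (inl (dtgt a)) - f (inl (dsrc a)) + edge_moment point_loc D a.
Proof.
move=> PLf fD; pose g u := f (dart_point a u); pose H := hinges (dart_chips D a).
have [c gc] : exists c, right_germ g 0 c by apply: dart_right; rewrite // lexx ltr01.
exists c; first by apply: germ_eq gc _; exists 1 => // h _; rewrite add0r.
have H0 : right_germ H 0 0.
  have := hinges_right (dart_chips D a) 0; rewrite big1_seq // => x /andP[_ /dart_chips_itv /andP[x0 _]].
  by rewrite leNgt x0 mulr0.
have := @convex_chord _ (fun u => g u + H u) c; rewrite -[c in right_germ _ _ c]addr0.
move=> /(_ (germD gc H0)).
have -> : g 0 + H 0 = f (inl (dsrc a)).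
  rewrite /g dart_point0 /H hinges_le0 ?addr0 // => x /dart_chips_itv /andP[/ltW] //.
have -> : g 1 + H 1 = f (inl (dtgt a)) + edge_moment point_loc D a.
  rewrite /g dart_point1 /H hinges_ge ?dart_chips_moment // => x /dart_chips_itv /andP[_ /ltW] //.
move=> chord; suff : f (inl (dsrc a)) + c%:~R <=
    f (inl (dtgt a)) + edge_moment point_loc D a by lra.
apply: chord.
- move=> t t01; have [cl gl] := dart_left a PLf t01.
  by eexists; apply: germD gl (hinges_left _ _).
- move=> t /andP[t0 t1]; have [cr gr] := dart_right a PLf (introT andP (conj (ltW t0) t1)).
  by eexists; apply: germD gr (hinges_right _ _).
move=> t c1 c2 t01; have /andP[t0 t1] := t01.
have [cl gl] := dart_left a PLf (introT andP (conj t0 (ltW t1))).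
have [cr gr] := dart_right a PLf (introT andP (conj (ltW t0) t1)).
move=> /(germ_uniq (germD gl (hinges_left _ _))) <-.
move=> /(germ_uniq (germD gr (hinges_right _ _))) <-.
have := fD (dart_point a t); rewrite div_interior // (germ_incoming gr) (germ_incoming gl).
rewrite -(dart_chips_at _ _ t01).
have -> : \sum_(x <- dart_chips D a) x.1 * (x.2 == t)%:Z =
    \sum_(x <- dart_chips D a) x.1 * (x.2 <= t)%R%:Z -
    \sum_(x <- dart_chips D a) x.1 * (x.2 < t)%R%:Z.
  rewrite -sumrB; apply: eq_bigr => x _; rewrite -mulrBr; congr (_ * _).
  by rewrite le_eqVlt; case: ltgtP.
lra.
Qed.

Lemma metric_vertex_part D x : vertex_part point_loc D x = coeff (inl x : point) D.
Proof.
rewrite -freeg_sum_coeff; apply: eq_freeg_sum => p.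
by rewrite /at_vertex -(inj_eq point_loc_inj).
Qed.

Lemma metric_solvable D : equiv_effective (@metric_equiv R Gamma) D ->
  solvable (vertex_part point_loc D) (edge_moment point_loc D).
Proof.
move=> [D' D'e [f PLf fD]]; exists (fun x => f (inl x)) => x.
have fE p : div f p = coeff p D - coeff p D' by rewrite -fD coeffB.
have fle p : div f p <= coeff p D by rewrite fE lerBlDr lerDl; exact: D'e.
rewrite /chips metric_vertex_part.
have := fE (inl x); rewrite div_vertex => dE.
apply: (@le_trans _ _ (coeff (inl x : point) D')); first exact: D'e.
have -> : coeff (inl x : point) D' = coeff (inl x : point) D -
  \sum_(a : dart G | dsrc a == x) incoming_slope (fun h => f (dart_point a h)) by rewrite dE; ring.
rewrite lerD2l -sumrN; apply: ler_sum => a _.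
have [c gc cle] := metric_chord a PLf fle.
by rewrite (germ_incoming gc) opprK floor_ge_int.
Qed.

(** A potential with the prescribed values [f] at the vertices: along each edge it
    starts with the slope [edge_slope], bends at the chips of [D], and bends
    upwards once more, at distance [edge_spare] from the target, in order to
    reach the right value there. *)
Section Interpolation.
Variables (D : {freeg point}) (f : vertex G -> R).

Definition edge_rise (e : edge G) : R := f (tgt e) - f (src e) + edge_moment point_loc D (e, true).
Definition edge_slope (e : edge G) : int := Num.floor (edge_rise e).
Definition edge_spare (e : edge G) : R := edge_rise e - (edge_slope e)%:~R.

Definition edge_bends (e : edge G) : seq (int * R) :=
  (1, 1 - edge_spare e) :: [seq (- x.1, x.2) | x <- dart_chips D (e, true)].

Definition edge_potential (e : edge G) t : R :=
  f (src e) + (edge_slope e)%:~R * t + hinges (edge_bends e) t.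

Definition potential (p : point) : R :=
  match p with
  | inl x => f x
  | inr z => edge_potential (val z).1 (val z).2
  end.

Lemma edge_spare_itv e : 0 <= edge_spare e < 1.
Proof. by have := floor_itv (edge_rise e); rewrite /edge_spare /edge_slope intrD; lra. Qed.

Lemma edge_bends_itv e x : x \in edge_bends e -> 0 < x.2 <= 1.
Proof.
rewrite inE => /orP[/eqP -> /=|/mapP[y /dart_chips_itv yi -> /=]].
  by have := edge_spare_itv e; lra.
by case/andP: yi => -> /ltW.
Qed.

Lemma edge_potential0 e : edge_potential e 0 = f (src e).
Proof.
rewrite /edge_potential mulr0 hinges_le0 ?addr0 // => x /edge_bends_itv /andP[/ltW] //.
Qed.

Lemma edge_potential1 e : edge_potential e 1 = f (tgt e).
Proof.
rewrite /edge_potential mulr1 hinges_ge => [|x /edge_bends_itv /andP[] //].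
rewrite big_cons big_map /=.
under eq_bigr do rewrite mulrNz mulNr.
by rewrite sumrN dart_chips_moment /edge_spare /edge_rise /=; ring.
Qed.

Lemma potential_segment e t : 0 <= t <= 1 ->
  potential (segment (Gamma := Gamma) e t) = edge_potential e t.
Proof.
move=> /andP[t0 t1]; have [->|tn0] := eqVneq t 0; first by rewrite segment0 edge_potential0.
have [->|tn1] := eqVneq t 1; first by rewrite segment1 edge_potential1.
by rewrite /segment insubT //= ?lt_def ?tn0 ?t0 //= eq_sym tn1 t1.
Qed.

Lemma potential_PL : PL potential.
Proof.
move=> e; apply: (PL_on_build (B := [seq x.2 | x <- edge_bends e])) => t0 t1 h0 h01 h1 out.
eexists => t tt; rewrite !potential_segment; last 2 first.
- by rewrite h0 (le_trans h01).
- by case/andP: tt => h2 h3; rewrite (le_trans h0 h2) (le_trans h3 h1).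
rewrite /edge_potential (hinges_affine _ tt) => [|x xe]; last first.
  by apply: out; apply: map_f.
set c := \sum_(x <- _) _.
have -> : f (src e) + (edge_slope e)%:~R * t + (hinges (edge_bends e) t0 + c%:~R * (t - t0)) =
  f (src e) + (edge_slope e)%:~R * t0 + hinges (edge_bends e) t0 + (edge_slope e + c)%:~R * (t - t0).
  by rewrite intrD; ring.
by [].
Qed.

Lemma potential_right e t : 0 <= t < 1 ->
  right_germ (fun u => potential (segment (Gamma := Gamma) e u)) t
    (edge_slope e + \sum_(x <- edge_bends e) x.1 * (x.2 <= t)%R%:Z).
Proof.
move=> /andP[t0 t1]; apply: germ_eq (germD (germ_affine (f (src e) + (edge_slope e)%:~R * t) (edge_slope e))
  (hinges_right _ _)) _.
exists (1 - t); first by rewrite subr_gt0.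
move=> h /andP[h0 ht]; rewrite potential_segment ?/edge_potential; first by ring.
by apply/andP; split; lra.
Qed.

Lemma potential_left e t : 0 < t <= 1 ->
  left_germ (fun u => potential (segment (Gamma := Gamma) e u)) t
    (- edge_slope e - \sum_(x <- edge_bends e) x.1 * (x.2 < t)%R%:Z).
Proof.
move=> /andP[t0 t1]; apply: germ_eq (germD (germ_affine (f (src e) + (edge_slope e)%:~R * t) (- edge_slope e))
  (hinges_left _ _)) _.
exists t => // h /andP[h0 ht]; rewrite potential_segment ?/edge_potential.
  by rewrite mulrNz; ring.
by apply/andP; split; lra.
Qed.

(** The only chip left inside the edge is the one at the last bend. *)
Lemma potential_interior e t : 0 < t < 1 ->
  coeff (segment (Gamma := Gamma) e t) D - div potential (segment (Gamma := Gamma) e t) =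
  (1 - edge_spare e == t)%R%:Z.
Proof.
move=> t01; have /andP[t0 t1] := t01.
have := div_interior potential (e, true) t01; rewrite /dart_point /= => ->.
rewrite (germ_incoming (potential_right e (introT andP (conj (ltW t0) t1)))).
rewrite (germ_incoming (potential_left e (introT andP (conj t0 (ltW t1))))).
have <- := dart_chips_at D (e, true) t01.
rewrite !big_cons !(big_map (fun x : int * R => (- x.1, x.2))) /= !mul1r.
have -> : (1 - edge_spare e == t)%R%:Z = (1 - edge_spare e <= t)%R%:Z - (1 - edge_spare e < t)%R%:Z.
  by rewrite le_eqVlt; case: ltgtP.
have -> : \sum_(x <- dart_chips D (e, true)) x.1 * (x.2 == t)%R%:Z =
    \sum_(x <- dart_chips D (e, true)) x.1 * (x.2 <= t)%R%:Z -
    \sum_(x <- dart_chips D (e, true)) x.1 * (x.2 < t)%R%:Z.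
  rewrite -sumrB; apply: eq_bigr => x _; rewrite -mulrBr; congr (_ * _).
  by rewrite le_eqVlt; case: ltgtP.
have negE (P : pred (int * R)) : \sum_(x <- dart_chips D (e, true)) - x.1 * (P x)%:Z =
    - \sum_(x <- dart_chips D (e, true)) x.1 * (P x)%:Z.
  by rewrite -sumrN; apply: eq_bigr => x _; rewrite mulNr.
rewrite (negE (fun x => x.2 <= t)) (negE (fun x => x.2 < t)); ring.
Qed.

Lemma potential_gain (a : dart G) :
  gain (edge_moment point_loc D) f a <=
  - incoming_slope (fun h => potential (dart_point a h)).
Proof.
case: a => e []; rewrite /dart_point /=.
  have := potential_right e (t := 0); rewrite lexx ltr01 => /(_ isT) gr.
  have {}gr : germ (fun h => potential (segment (Gamma := Gamma) e h))
      (edge_slope e + \sum_(x <- edge_bends e) x.1 * (x.2 <= 0)%R%:Z).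
    by apply: germ_eq gr _; exists 1 => // h _; rewrite add0r.
  rewrite (germ_incoming gr) opprK big1_seq ?addr0 //.
  by move=> x /andP[_ /edge_bends_itv /andP[x0 _]]; rewrite leNgt x0 mulr0.
have := potential_left e (t := 1); rewrite lexx ltr01 => /(_ isT) gl.
rewrite (germ_incoming gl) opprK big_cons (big_map (fun x : int * R => (- x.1, x.2))) /= mul1r.
rewrite (eq_big_seq (fun x : int * R => - x.1)) => [|x /dart_chips_itv /andP[_ x1]]; last first.
  by rewrite /= x1 mulr1.
rewrite sumrN dart_chips_degree /=; set z := gain _ _ _.
have hz : z%:~R <= (edge_degree point_loc D e)%:~R - edge_rise e.
  rewrite -edge_moment_degree; apply: le_trans (floor_le _) _.
  by rewrite /edge_rise /dsrc /dtgt /=; lra.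
have rE : edge_rise e = (edge_slope e)%:~R + edge_spare e by rewrite /edge_spare addrC subrK.
have [r0 _] := andP (edge_spare_itv e); case: ltP => h1.
  suff : edge_slope e + z < edge_degree point_loc D e by lia.
  by rewrite -(ltr_int R) intrD; lra.
suff : edge_slope e + z <= edge_degree point_loc D e by lia.
by rewrite -(ler_int R) intrD; lra.
Qed.

End Interpolation.

Lemma metric_effectiveP D : equiv_effective (@metric_equiv R Gamma) D <->
  solvable (vertex_part point_loc D) (edge_moment point_loc D).
Proof.
split; first exact: metric_solvable.
move=> [f fP]; pose F := potential D f.
pose c x := coeff (inl x : point) D - div F (inl x).
pose rest e : {freeg point} := if 1 - edge_spare D f e == 1 then 0
  else << segment (Gamma := Gamma) e (1 - edge_spare D f e) >>.
pose D' : {freeg point} := \sum_x << inl x : point >> *~ c x + \sum_e rest e.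
have D'E p : coeff p D' = coeff p D - div F p.
  have spare_loc e : 1 - edge_spare D f e != 1 ->
      point_loc (segment (Gamma := Gamma) e (1 - edge_spare D f e)) =
      inr (e, 1 - edge_spare D f e).
    move=> h; apply: segment_loc; have := edge_spare_itv D f e.
    by move: h; rewrite neq_lt => /orP[]; lra.
  have restE e q : coeff q (rest e) = (point_loc q == inr (e, 1 - edge_spare D f e))%:Z.
    rewrite /rest; case: eqP => [h|/eqP h].
      rewrite coeff0; case: eqP => // /point_loc_itv; rewrite h ltxx andbF //.
    rewrite coeffU mul1r -(inj_eq point_loc_inj) spare_loc // eq_sym.
    by case: eqP.
  rewrite coeffD !raddf_sum /= (eq_bigr (fun x => c x * (inl x == p)%:Z)) => [|x _]; last first.
    by rewrite raddfMz /= coeffU mul1r mulrzz mulrC; case: eqP.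
  under [X in _ + X]eq_bigr do rewrite restE.
  case: p => [x|[[e t] et]].
    rewrite [X in _ + X]big1 // addr0 (bigD1 x) //= eqxx mulr1 big1 ?addr0 // => y /negPf yx.
    by rewrite (inj_eq (@inl_inj _ _)) yx mulr0.
  have := potential_interior D f e et; rewrite /segment insubT // => ->.
  rewrite big1 ?add0r => [|x _]; last by rewrite mulr0.
  rewrite (bigD1 e) //= big1 ?addr0 => [|e' /negPf e'e].
    by rewrite (inj_eq (@inr_inj _ _)) xpair_eqE eqxx eq_sym.
  by rewrite (inj_eq (@inr_inj _ _)) xpair_eqE eq_sym e'e.
have c_ge0 x : 0 <= c x.
  apply: le_trans (fP x) _; rewrite /chips metric_vertex_part /c div_vertex lerD2l -sumrN.
  by apply: ler_sum => a _; exact: potential_gain.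
exists D'; last first.
  by exists F; [exact: potential_PL|move=> p; rewrite coeffB D'E subKr].
move=> p; rewrite D'E; case: p => [x|[[e t] et]]; first exact: c_ge0.
have := potential_interior D f e et; rewrite /segment insubT // => ->.
by [].
Qed.

End MetricModel.

(** * Quasi-banana graphs are layered *)
Section QuasiBananaLayers.
Local Open Scope nat_scope.

Lemma mult_edges (H : graph) (x y : vertex H) :
  mult x y = \sum_e (((src e == x) && (tgt e == y)) + ((tgt e == x) && (src e == y))).
Proof.
rewrite /mult big_mkcond sum_dart; apply: eq_bigr => e _; rewrite /dsrc /dtgt /=.
by do 2![case: ifP => _].
Qed.

(** An isomorphism may reverse edges, which [mult] does not see. *)
Lemma mult_isomorphic (G H : graph) (fV : vertex G -> vertex H) (fE : edge G -> edge H) :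
    bijective fV -> bijective fE ->
    (forall e, (src (fE e) = fV (src e) /\ tgt (fE e) = fV (tgt e)) \/
               (src (fE e) = fV (tgt e) /\ tgt (fE e) = fV (src e))) ->
  forall x y, mult x y = mult (fV x) (fV y).
Proof.
move=> /bij_inj fVi fEb fE_ends x y; rewrite !mult_edges.
rewrite [RHS](reindex fE); last exact: onW_bij.
apply: eq_bigr => e _; case: (fE_ends e) => -[-> ->]; rewrite !(inj_eq fVi) //.
by rewrite addnC.
Qed.

Variables (m : nat) (N : m.-tuple nat) (N_gt0 : all (fun q => 0 < q) N).

Local Notation QB := (QB N_gt0).

Lemma qb_vertex_inj (u v : vertex QB) :
  tag u = tag v :> nat -> tagged u = tagged v :> nat -> u = v.
Proof.
case: u v => [i j] [i' j'] /= /val_inj ii'; case: _ / ii' in j' * => jj'.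
by congr existT; apply: val_inj.
Qed.

Lemma mult_qb (u v : vertex QB) : mult u v = qb_mult u v + qb_mult v u.
Proof.
have count p : \sum_(e : edge QB) ((tag e == p) : nat) = qb_mult p.1 p.2.
  transitivity (\sum_(p' | p' == p) \sum_(j : 'I_(@qb_mult m N p'.1 p'.2)) 1).
    rewrite sig_big_dep [RHS]big_mkcond; apply: eq_bigr => e _.
    by rewrite andbT; case: eqP.
  by rewrite big_pred1_eq sum1_card card_ord.
rewrite mult_edges big_split /= -(count (u, v)) -(count (v, u)).
congr (_ + _); apply: eq_bigr => e _; congr nat_of_bool.
by case: e => -[p1 p2] j; rewrite xpair_eqE andbC.
Qed.

Lemma card_qb_layer k : k <= m -> #|[pred u : vertex QB | tag u == k :> nat]| = layer_size N k.
Proof.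
move=> km; rewrite -sum1_card.
transitivity (\sum_(i : 'I_m.+1 | i == k :> nat) \sum_(j : 'I_(layer_size N i)) 1).
  by rewrite sig_big_dep; apply: eq_bigl => u; rewrite inE andbT.
rewrite (big_pred1 (inord k)) => [|i]; last by rewrite /= -val_eqE /= inordK.
by rewrite sum1_card card_ord inordK.
Qed.

Definition qb_hub i : vertex QB :=
  Tagged (fun i : 'I_m.+1 => 'I_(layer_size N i))
    (Ordinal (layer_size_gt0 N_gt0 (ltn_ord (inord i : 'I_m.+1)))).

Lemma qb_hubE (u : vertex QB) : (u == qb_hub (tag u)) = (tagged u == 0 :> nat).
Proof.
apply/eqP/eqP => [->|u0] //; apply: qb_vertex_inj => //=.
by rewrite inordK.
Qed.

Theorem quasi_banana_layered G : isomorphic G QB ->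
  exists lay hub, layered (G := G) m lay hub.
Proof.
move=> [fV [fE [fVb fEb fE_ends]]]; have multE := mult_isomorphic fVb fEb fE_ends.
have [g fVK gK] := fVb.
pose lay x := tag (fV x) : nat; pose hub i := g (qb_hub i).
have hubE x : (x == hub (lay x)) = (tagged (fV x) == 0 :> nat).
  by rewrite -qb_hubE -(inj_eq (can_inj fVK)) gK.
have cardE k : k <= m -> #|[pred x | lay x == k]| = layer_size N k.
  move=> /card_qb_layer <-; rewrite -!sum1_card [RHS](reindex fV) //.
  exact: onW_bij.
have belowE i : i <= m -> below lay i = \sum_(1 <= k < i.+1) layer_size N k.
  move=> im; apply: eq_big_nat => k /andP[_ ki]; apply: cardE.
  by apply: leq_trans im.
have lay_m x : lay x <= m by rewrite -ltnS ltn_ord.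
exists lay, hub; split=> //.
- by move=> i im; rewrite /lay gK /= inordK.
- move=> x x0; apply/eqP; rewrite -[X in hub X]x0 hubE.
  move: x0; rewrite /lay; case: (fV x) => i j /= i0; move: j; rewrite i0.
  by case=> -[].
- move=> x y xy lxy; rewrite multE mult_qb /qb_mult -!/(lay _).
  have -> : lay x == lay y = true by apply/eqP.
  have -> : lay y == lay x = true by apply/eqP.
  have : tagged (fV x) != tagged (fV y) :> nat.
    by apply: contraNneq xy => h; apply/eqP/(can_inj fVK)/qb_vertex_inj.
  by case: ltngtP.
- move=> x y lxy; rewrite multE mult_qb /qb_mult hubE belowE // -!/(lay _).
  have -> : lay y == (lay x).+1 = true by rewrite lxy eqxx.
  have -> : lay x == lay y = false by apply/negbTE; rewrite neq_ltn lxy leqnn.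
  have -> : lay y == lay x = false by apply/negbTE; rewrite neq_ltn lxy leqnn orbT.
  have -> : lay x == (lay y).+1 = false by apply/negbTE; rewrite neq_ltn lxy leqW.
  by rewrite addn0.
move=> x y lxy; rewrite multE mult_qb /qb_mult -!/(lay _).
have lt_xy : lay x < lay y by exact: ltnW.
have -> : lay y == (lay x).+1 = false by rewrite gtn_eqF.
have -> : lay x == lay y = false by rewrite ltn_eqF.
have -> : lay y == lay x = false by rewrite gtn_eqF.
by have -> : lay x == (lay y).+1 = false by rewrite ltn_eqF // ltnW.
Qed.

End QuasiBananaLayers.

(** * Gonalities of the graph, its subdivisions and the metric graph *)
Section Gonalities.
Variables (R : realType) (G : graph) (m : nat).
Variables (lay : vertex G -> nat) (hub : nat -> vertex G).
Hypothesis HG : layered m lay hub.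

Local Notation n := (below lay m + 1)%N%:Z.

Lemma graph_gonalities : graph_gonality G 1 n /\ graph_gonality G 2 (n + 1).
Proof.
by apply: (model_gonality (loc := @graph_loc R G) (vert := id) _ _ (@graph_effectiveP R G) HG).
Qed.

Lemma subdivision_gonalities l :
  graph_gonality (subdivision l G) 1 n /\ graph_gonality (subdivision l G) 2 (n + 1).
Proof.
apply: (model_gonality (loc := @sub_loc R l G) (vert := inl) _ _ (@sub_effectiveP R l G) HG) => //.
exact: sub_loc_itv.
Qed.

Lemma metric_gonalities :
  metric_gonality (unit_metric R G) 1 n /\ metric_gonality (unit_metric R G) 2 (n + 1).
Proof.
apply: (model_gonality (loc := @point_loc R G) (vert := inl) _ _ (@metric_effectiveP R G) HG) => //.
by move=> p e t /point_loc_itv /andP[/ltW -> /ltW].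
Qed.

End Gonalities.

Theorem theorem3 (R : realType) (G : graph) (k : int)
    (G_qb : quasi_banana G) (G_gon : graph_gonality G 1 k) :
  (forall l : nat, (1 <= l)%N ->
     graph_gonality_tight (subdivision l G) /\
     graph_gonality (subdivision l G) 1 k) /\
  metric_gonality_tight (unit_metric R G).
Proof.
have [m [N [N_gt0 /quasi_banana_layered[lay [hub HG]]]]] := G_qb.
have [G1 _] := graph_gonalities R HG.
have -> := gonality_unique G_gon G1.
split=> [l _|]; last by exists (below lay m + 1)%N%:Z; exact: metric_gonalities HG.
have [S1 S2] := subdivision_gonalities R HG l.
by split=> //; exists (below lay m + 1)%N%:Z.
Qed.
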